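(* Let $f=[f_1,\dots,f_r]^T$ with $f_j\in R=\mathbb{Q}[x_1,\dots,x_n]$, let $i\in\{0,\dots,n-1\}$, and let $X=\mathcal{V}(f)\subset\mathbb{C}^n$. For general choices of $\Theta\in\mathbb{Q}^{i\times n}$, $\Lambda\in\mathbb{Q}^{(n-i)\times r}$ and $\mu\in\mathbb{Q}^r$, the ideal $I_i(\Theta,\Lambda,\mu)=\langle\Theta\cdot x-\mathbf{1},\ \Lambda\cdot f,\ 1-(\mu\cdot f)T\rangle\subset R[T]$ is either the unit ideal or has dimension $0$. In either case, $$g_i(X,\mathbb{C}^n)=\dim_{\mathbb{Q}}\big(R[T]/I_i(\Theta,\Lambda,\mu)\big),$$ and this value is independent of $\Theta,\Lambda,\mu$ (provided they are general).
   Context: $T$ is a new variable, $x=(x_1,\dots,x_n)^T$, and $\mathbf{1}$ is the length-$i$ vector of ones. $\mathcal{V}(\cdot)$ denotes the common complex zero set. The number $g_i(X,\mathbb{C}^n)$ is defined as $\deg\big(\mathcal{V}(\Theta\cdot x-\mathbf{1},\Lambda\cdot f)\setminus X\big)$ for general $\Theta\in\mathbb{C}^{i\times n}$ and $\Lambda\in\mathbb{C}^{(n-i)\times r}$, i.e. the number of solutions (counted with multiplicity) of $i$ general affine linear equations and $n-i$ general linear combinations of $f_1,\dots,f_r$ lying outside $X$. *)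

(* Defs.v *)
From mathcomp Require Import all_boot all_algebra.
From mathcomp Require Import reals complex.
From mathcomp Require Import mpoly.

Set Implicit Arguments.
Unset Strict Implicit.
Unset Printing Implicit Defensive.

Import GRing.Theory.
Local Open Scope ring_scope.

Section PolyIdeals.
Variables (K : fieldType) (n : nat).
Local Notation P := {mpoly K[n]}.

Definition ideal_of (S : P -> Prop) (p : P) : Prop :=
  exists (m : nat) (h g : 'I_m -> P),
    (forall k, S (g k)) /\ p = \sum_(k < m) h k * g k.

Definition unit_ideal (S : P -> Prop) : Prop := ideal_of S 1.

Definition quot_dim (I : P -> Prop) (N : nat) : Prop :=
  exists b : 'I_N -> P,
    (forall c : 'I_N -> K, I (\sum_(k < N) c k *: b k) -> forall k, c k = 0) /\
    (forall p : P, exists c : 'I_N -> K, I (p - \sum_(k < N) c k *: b k)).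

Definition evalp (L : fieldType) (phi : K -> L) (v : 'rV[L]_n) (p : P) : L :=
  mmap phi (fun j => v 0 j) p.

Definition zeros (L : fieldType) (phi : K -> L) (S : P -> Prop) (v : 'rV[L]_n)
  : Prop := forall p, S p -> evalp phi v p = 0.

(* <S> has dimension 0 : proper ideal with finitely many zeros over the
   algebraically closed field L (L = the complex numbers below). *)
Definition zero_dim (L : fieldType) (phi : K -> L) (S : P -> Prop) : Prop :=
  ~ unit_ideal S /\
  exists s : seq 'rV[L]_n, forall v, zeros phi S v -> v \in s.

Definition mpow_gens (p : 'rV[K]_n) (e : nat) (q : P) : Prop :=
  exists a : 'I_n -> nat,
    (\sum_(j < n) a j)%N = e /\ q = \prod_(j < n) ('X_j - (p 0 j)%:MP) ^+ a j.

(* local multiplicity m of the (isolated) point p of V(S):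
   m = dim_K K[x]_p / <S>K[x]_p, computed as dim_K K[x]/(<S> + m_p^e)
   for all sufficiently large e. *)
Definition local_mult (S : P -> Prop) (p : 'rV[K]_n) (m : nat) : Prop :=
  exists e0 : nat, forall e : nat, (e0 <= e)%N ->
    quot_dim (ideal_of (fun q => S q \/ mpow_gens p e q)) m.

End PolyIdeals.

Section Objects.
Variables (n r i : nat).

Section ComplexSide.
Variable (R : realType).
Local Notation C := (R[i]).

Definition fC (f : 'I_r -> {mpoly rat[n]}) (j : 'I_r) : {mpoly C[n]} :=
  mmap (fun c : rat => (ratr c : C)%:MP) (fun k => 'X_k) (f j).

Definition inX (f : 'I_r -> {mpoly rat[n]}) (v : 'rV[C]_n) : Prop :=
  forall j, evalp (@ratr C) v (f j) = 0.

Definition Jgens (f : 'I_r -> {mpoly rat[n]})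
  (Th : 'M[C]_(i, n)) (La : 'M[C]_(n - i, r)) (q : {mpoly C[n]}) : Prop :=
  (exists k : 'I_i, q = \sum_(j < n) Th k j *: 'X_j - 1) \/
  (exists k : 'I_(n - i), q = \sum_(j < r) La k j *: fC f j).

Definition deg_outside (f : 'I_r -> {mpoly rat[n]})
  (Th : 'M[C]_(i, n)) (La : 'M[C]_(n - i, r)) (N : nat) : Prop :=
  exists (s : seq 'rV[C]_n) (m : 'rV[C]_n -> nat),
    uniq s /\
    (forall v, (zeros idfun (Jgens f Th La) v /\ ~ inX f v) <-> v \in s) /\
    (forall v, v \in s -> local_mult (Jgens f Th La) v (m v)) /\
    (\sum_(v <- s) m v)%N = N.

(* g_i(X, C^n) = N : for (Theta, Lambda) in a nonempty Zariski open subset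
   of C^{i x n} x C^{(n-i) x r}, the degree above equals N. *)
Definition is_gi (f : 'I_r -> {mpoly rat[n]}) (N : nat) : Prop :=
  exists PC : {mpoly C[i * n + (n - i) * r]},
    PC != 0 /\
    forall (Th : 'M[C]_(i, n)) (La : 'M[C]_(n - i, r)),
      evalp idfun (row_mx (mxvec Th) (mxvec La)) PC != 0 ->
      deg_outside f Th La N.

End ComplexSide.

(* R[T] = Q[x_1..x_n, T], with T the last variable 'X_(ord_max) *)
Definition liftT (p : {mpoly rat[n]}) : {mpoly rat[n.+1]} :=
  mmap (@mpolyC n.+1 rat) (fun j => 'X_(widen_ord (leqnSn n) j)) p.

Definition Igens (f : 'I_r -> {mpoly rat[n]})
  (Th : 'M[rat]_(i, n)) (La : 'M[rat]_(n - i, r)) (mu : 'rV[rat]_r)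
  (q : {mpoly rat[n.+1]}) : Prop :=
  (exists k : 'I_i,
      q = \sum_(j < n) Th k j *: 'X_(widen_ord (leqnSn n) j) - 1) \/
  (exists k : 'I_(n - i), q = \sum_(j < r) La k j *: liftT (f j)) \/
  q = 1 - (\sum_(j < r) mu 0 j *: liftT (f j)) * 'X_(@ord_max n).

End Objects.

(* Main.v *)
From HB Require Import structures.
Require Import Defs.
From mathcomp Require Import all_boot all_algebra.
From mathcomp Require Import boolp reals complex.
From mathcomp Require Import ssrcomplements mpoly.
From mathcomp Require Import ring.

(** Let A = Q[Theta, Lambda, mu] and let K be its fraction field. On the chart
    where x_l, f_s and mu.f are invertible, the equations can be solved for the
    l-th column of Theta, the s-th column of Lambda and T, so that all the
    parameters together with any one of the variables x_j, T are rational functions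
    of as many elements as there are parameters. Counting monomials gives an algebraic
    relation, and, the charts covering the zero set, K[x,T]/I is finite
    dimensional, of dimension N say. A basis of this quotient and the structure
    constants of multiplication by the variables survive every specialisation of the
    parameters outside a hypersurface D = 0, over Q as well as over C, so that
    the dimension of the quotient is N there.
    Over C, for given Theta, Lambda only finitely many points lie
    outside X, since N+1 of them would survive in a common fibre mu.f <> 0; a
    general mu then misses none of them, and the finite-dimensional algebra
    C[x,T]/I splits as the product of the local algebras at these points. *)

Set Implicit Arguments.
Unset Strict Implicit.
Unset Printing Implicit Defensive.

Import GRing.Theory Num.Theory.
Local Open Scope ring_scope.

(** * Ideals and dimensions of quotients *)

(** The count of monomials closes because the i equations in Theta and the n - i equations in Lambda
    free exactly n parameter slots, the room needed for x_1, .., x_n; T costs none, being the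
    inverse of mu.f. A dimension over Q and a number of points over C agree because both are
    specialisations of one algebra over K, outside one hypersurface whose equation D has rational
    coefficients. Spanning specialises by identities alone; independence does not, and is carried by
    the coordinate forms of the basis. The parameter mu enters the ideal but not g_i, and is handled
    in two opposite ways: frozen at a rational value, it turns D into a condition on Theta and
    Lambda; set free again over a fixed pair Theta, Lambda, it provides values for which mu.f
    vanishes at none of the finitely many points outside X. Multiplicities survive the removal of T
    because mu.f is a unit in each local algebra concerned. *)

Record is_ideal (E : comNzRingType) (I : E -> Prop) : Prop := IsIdeal {
  ideal_0 : I 0;
  ideal_D : forall p q, I p -> I q -> I (p + q);
  ideal_Ml : forall p q, I q -> I (p * q) }.

Section IdealTheory.
Variables (E : comNzRingType) (I : E -> Prop).
Hypothesis idI : is_ideal I.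

Lemma ideal_Mr p q : I p -> I (p * q).
Proof. by move=> Ip; rewrite mulrC; apply: ideal_Ml. Qed.

Lemma ideal_N p : I p -> I (- p).
Proof. by move=> Ip; rewrite -mulN1r; apply: ideal_Ml. Qed.

Lemma ideal_B p q : I p -> I q -> I (p - q).
Proof. by move=> Ip Iq; apply: ideal_D => //; apply: ideal_N. Qed.

Lemma ideal_sum (T : Type) (s : seq T) (P : pred T) (F : T -> E) :
  (forall t, P t -> I (F t)) -> I (\sum_(t <- s | P t) F t).
Proof.
by move=> IF; apply: big_ind => //; [apply: ideal_0 | apply: ideal_D].
Qed.

Lemma cong_trans q p r : I (p - q) -> I (q - r) -> I (p - r).
Proof. by move=> h1 h2; rewrite -(subrKA q); apply: ideal_D. Qed.

Lemma cong_sym p q : I (p - q) -> I (q - p).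
Proof. by move=> h; rewrite -opprB; apply: ideal_N. Qed.

Lemma congM p p' q q' : I (p - p') -> I (q - q') -> I (p * q - p' * q').
Proof.
move=> hp hq; apply: (@cong_trans (p * q')).
  by rewrite -mulrBr; apply: ideal_Ml.
by rewrite -mulrBl; apply: ideal_Mr.
Qed.

Lemma cong_refl p : I (p - p).
Proof. by rewrite subrr; apply: ideal_0. Qed.

Lemma congX p q k : I (p - q) -> I (p ^+ k - q ^+ k).
Proof.
move=> h; elim: k => [|k IHk]; first exact: cong_refl.
by rewrite !exprS; apply: congM.
Qed.

Lemma cong_sum (T : Type) (s : seq T) (P : pred T) (F G : T -> E) :
  (forall t, P t -> I (F t - G t)) ->
  I (\sum_(t <- s | P t) F t - \sum_(t <- s | P t) G t).
Proof. by move=> h; rewrite -sumrB; apply: ideal_sum. Qed.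

Lemma cong_prod (T : Type) (s : seq T) (P : pred T) (F G : T -> E) :
  (forall t, P t -> I (F t - G t)) ->
  I (\prod_(t <- s | P t) F t - \prod_(t <- s | P t) G t).
Proof.
move=> h; apply: (big_ind2 (fun x y => I (x - y))) => //.
- exact: cong_refl.
- by move=> *; apply: congM.
Qed.

End IdealTheory.

Section IdealOf.
Variables (K : fieldType) (n : nat).
Local Notation P := {mpoly K[n]}.
Implicit Types (S I : P -> Prop).

Lemma ideal_of_is_ideal S : is_ideal (ideal_of S).
Proof.
split.
- exists 0%N, (fun=> 0), (fun=> 0); split; first by case.
  by rewrite big_ord0.
- move=> _ _ [m1 [h1 [g1 [S1 ->]]]] [m2 [h2 [g2 [S2 ->]]]].
  pose glue (u : 'I_m1 -> P) (v : 'I_m2 -> P) k :=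
    match split k with inl a => u a | inr b => v b end.
  exists (m1 + m2)%N, (glue h1 h2), (glue g1 g2); split.
    by move=> k; rewrite /glue; case: (split k).
  rewrite big_split_ord /=; congr (_ + _); apply: eq_bigr => k _.
    by rewrite /glue -/(unsplit (inl k)) unsplitK.
  by rewrite /glue -/(unsplit (inr k)) unsplitK.
- move=> p _ [m [h [g [Sg ->]]]]; exists m, (fun k => p * h k), g; split => //.
  by rewrite mulr_sumr; apply: eq_bigr => k _; rewrite mulrA.
Qed.

Lemma ideal_of_gen S p : S p -> ideal_of S p.
Proof.
move=> Sp; exists 1%N, (fun=> 1), (fun=> p); split => //.
by rewrite big_ord1 mul1r.
Qed.

Lemma ideal_of_min S I : is_ideal I -> (forall p, S p -> I p) ->
  forall p, ideal_of S p -> I p.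
Proof.
move=> idI SI _ [m [h [g [Sg ->]]]].
by apply: (ideal_sum idI) => k _; apply: ideal_Ml => //; apply: SI.
Qed.

Lemma ideal_Z I c p : is_ideal I -> I p -> I (c *: p).
Proof. by move=> idI Ip; rewrite -mul_mpolyC; apply: ideal_Ml. Qed.

Lemma congZ I c p q : is_ideal I -> I (p - q) -> I (c *: p - c *: q).
Proof. by move=> idI h; rewrite -scalerBr; apply: ideal_Z. Qed.

Lemma evalp_ideal_of (L : fieldType) (phi : {rmorphism K -> L}) S v p :
  zeros phi S v -> ideal_of S p -> evalp phi v p = 0.
Proof.
move=> Sv; apply: (@ideal_of_min _ (fun p => evalp phi v p = 0)) => //.
rewrite /evalp; split => [|q r|q r]; first exact: rmorph0.
  by move=> hq hr; rewrite rmorphD /= hq hr addr0.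
by move=> hr; rewrite rmorphM /= hr mulr0.
Qed.

End IdealOf.

Lemma wide_kernel (K : fieldType) m N (A : 'M[K]_(m, N)) :
  (N < m)%N -> exists2 v : 'rV_m, v != 0 & v *m A = 0.
Proof.
move=> ltNm; have : kermx A != 0.
  by rewrite kermx_eq0 /row_free neq_ltn (leq_ltn_trans (rank_leq_col A)).
by case/rowV0Pn => v /sub_kermxP; exists v.
Qed.

Section QuotDim.
Variables (K : fieldType) (n : nat).
Local Notation P := {mpoly K[n]}.
Implicit Types (I : P -> Prop).

Definition spanning I N (b : 'I_N -> P) :=
  forall p, exists c : 'I_N -> K, I (p - \sum_(k < N) c k *: b k).

Definition independent I N (b : 'I_N -> P) :=
  forall c : 'I_N -> K, I (\sum_(k < N) c k *: b k) -> forall k, c k = 0.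

(** If N < m, the m by N matrix of coordinates has a nonzero left kernel vector, which is a linear
    relation among the g_i modulo I. *)
Lemma independent_le_spanning I m N (g : 'I_m -> P) (b : 'I_N -> P) :
  is_ideal I -> independent I g -> spanning I b -> (m <= N)%N.
Proof.
move=> idI ind spn; rewrite leqNgt; apply/negP => ltNm.
have [c cP] := choice (fun i => spn (g i)).
have [v v0 vA] := wide_kernel (\matrix_(i, k) c i k) ltNm.
case/eqP: v0; apply/rowP => i; rewrite mxE; apply: (ind (v 0)).
have -> : \sum_(i < m) v 0 i *: g i
    = \sum_(i < m) v 0 i *: (g i - \sum_(k < N) c i k *: b k).
  transitivity (\sum_(i < m) v 0 i *: g i -
      \sum_(k < N) (v *m \matrix_(i, k) c i k) 0 k *: b k).
    by rewrite vA [X in _ - X]big1 ?subr0 // => k _; rewrite mxE scale0r.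
  rewrite [X in _ - X](_ : _ = \sum_(i < m) v 0 i *: \sum_(k < N) c i k *: b k).
    by rewrite -sumrB; apply: eq_bigr => k _; rewrite scalerBr.
  under [RHS]eq_bigr do rewrite scaler_sumr.
  rewrite exchange_big; apply: eq_bigr => k _ /=.
  rewrite mxE scaler_suml; apply: eq_bigr => j _.
  by rewrite mxE scalerA.
by apply: ideal_sum => // j _; apply: ideal_Z.
Qed.

Lemma quot_dim_uniq I N N' :
  is_ideal I -> quot_dim I N -> quot_dim I N' -> N = N'.
Proof.
move=> idI [b [ib sb]] [b' [ib' sb']]; apply/eqP.
by rewrite eqn_leq !(@independent_le_spanning I _ _ b b', @independent_le_spanning I _ _ b' b).
Qed.

Lemma eq_quot_dim I I' N : (forall p, I p <-> I' p) ->
  quot_dim I N -> quot_dim I' N.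
Proof.
move=> eqI; suff -> : I = I' by [].
by apply/funext => p; apply/propext.
Qed.

(** A relation with a nonzero coefficient at [k0] eliminates that member; repeating this thins the
    family out to a basis. *)
Lemma quot_dim_spanning I k (g : 'I_k -> P) :
  is_ideal I -> spanning I g -> exists2 N, quot_dim I N & (N <= k)%N.
Proof.
move=> idI; elim: k => [|k IHk] in g * => spn.
  by exists 0%N => //; exists g; split => // c _ [].
case: (pselect (independent I g)) => [ind|]; first by exists k.+1 => //; exists g.
case/existsNP => c /not_implyP [Ic /existsNP [k0 /eqP ck0]].
case: (IHk (fun j => g (lift k0 j))) => [p|N qN leN]; last first.
  by exists N => //; apply: leqW.
have [d dP] := spn p.
exists (fun j => d (lift k0 j) - d k0 / c k0 * c (lift k0 j)).
have : I (d k0 / c k0 *: \sum_(j < k.+1) c j *: g j) by apply: ideal_Z.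
move/(ideal_D idI dP); congr (I _).
rewrite (bigD1_ord k0) //= [X in _ + _ *: X](bigD1_ord k0) //=.
rewrite scalerDr scalerA divfK // opprD -!addrA; congr (_ + _).
rewrite addrCA addKr -[RHS]opprK; apply: canRL (opprK) _; rewrite opprD !opprK scaler_sumr -sumrB.
by apply: eq_bigr => j _; rewrite scalerBl scalerA.
Qed.

Lemma quot_dim_sub I I' N : is_ideal I -> is_ideal I' ->
  (forall p, I p -> I' p) -> quot_dim I N -> exists N', quot_dim I' N'.
Proof.
move=> idI idI' sub [b [_ spn]].
case: (@quot_dim_spanning I' N b) => // [p|N' ? _]; last by exists N'.
by have [c cP] := spn p; exists c; apply: sub.
Qed.

End QuotDim.

(** * Generic constancy of the dimension *)

Local Notation "x %:F" := (@FracField.tofrac _ x).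

Lemma map_mpoly_coef_eq (R1 R2 S : nzRingType) (f : {rmorphism R1 -> S})
    (h : {rmorphism R2 -> S}) m (p : {mpoly R1[m]}) (q : {mpoly R2[m]}) :
  map_mpoly f p = map_mpoly h q -> forall e, f p@_e = h q@_e.
Proof. by move=> pq e; rewrite -!mcoeff_map_mpoly pq. Qed.

Section RegularFractions.
Variables (A : idomainType) (L : fieldType) (chi : {rmorphism A -> L}).
Local Notation K := {fraction A}.

(** The local ring of A at the prime ideal ker chi, to which chi extends. *)
Definition regular : {pred K} :=
  fun u => `[< exists p q, chi q != 0 /\ u = p%:F / q%:F >].

Lemma regularP u :
  reflect (exists p q, chi q != 0 /\ u = p%:F / q%:F) (u \in regular).
Proof. exact: asboolP. Qed.

Lemma denom_neq0 q : chi q != 0 -> q%:F != 0.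
Proof. by apply: contra_neq => /eqP; rewrite tofrac_eq0 => /eqP ->; rewrite rmorph0. Qed.

Lemma regular_subring : subring_closed regular.
Proof.
split.
- by apply/regularP; exists 1, 1; rewrite rmorph1 oner_eq0 tofrac1 divr1.
- move=> _ _ /regularP[p [q [q0 ->]]] /regularP[p' [q' [q'0 ->]]].
  apply/regularP; exists (p * q' - p' * q), (q * q'); split.
    by rewrite rmorphM mulf_neq0.
  by rewrite tofracB !tofracM -[- (_ / _)]mulNr addf_div ?denom_neq0 // mulNr.
- move=> _ _ /regularP[p [q [q0 ->]]] /regularP[p' [q' [q'0 ->]]].
  apply/regularP; exists (p * p'), (q * q'); split.
    by rewrite rmorphM mulf_neq0.
  by rewrite !tofracM mulf_div.
Qed.

HB.instance Definition _ := GRing.isSubringClosed.Build K regular regular_subring.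

Record regfrac := RegFrac { regval :> K; _ : regval \in regular }.
HB.instance Definition _ := [isSub for regval].
HB.instance Definition _ := [Choice of regfrac by <:].
HB.instance Definition _ := [SubChoice_isSubComNzRing of regfrac by <:].
HB.instance Definition _ := GRing.RMorphism.copy regval (val : regfrac -> K).

Lemma regfrac_repr (x : regfrac) :
  exists pq : A * A, chi pq.2 != 0 /\ regval x = pq.1%:F / pq.2%:F.
Proof. by case: x => u /= /regularP[p [q h]]; exists (p, q). Qed.

Definition spec (x : regfrac) : L :=
  let pq := sval (cid (regfrac_repr x)) in chi pq.1 / chi pq.2.

(** [spec] reads off an arbitrarily chosen fraction. Two admissible fractions with the same value
    agree after cross-multiplication in A, and chi respects this identity. *)
Lemma specE x p q : chi q != 0 -> regval x = p%:F / q%:F -> spec x = chi p / chi q.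
Proof.
rewrite /spec; case: cid => -[p' q'] /= [q'0 ->] q0 /eqP.
rewrite eqr_div ?denom_neq0 // -!tofracM tofrac_eq => /eqP e.
by apply/eqP; rewrite eqr_div // -!rmorphM e.
Qed.

Lemma spec_zmod : zmod_morphism spec.
Proof.
move=> x y; have [[p q] /= [q0 xE]] := regfrac_repr x.
have [[p' q'] /= [q'0 yE]] := regfrac_repr y.
rewrite (specE q0 xE) (specE q'0 yE) (@specE _ (p * q' - p' * q) (q * q')).
- by rewrite rmorphB !rmorphM -[- (_ / _)]mulNr addf_div // mulNr.
- by rewrite rmorphM mulf_neq0.
- by rewrite /= xE yE tofracB !tofracM -[- (_ / _)]mulNr addf_div ?denom_neq0 // mulNr.
Qed.

Lemma spec_monoid : monoid_morphism spec.
Proof.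
split=> [|x y].
  by rewrite (@specE _ 1 1) ?rmorph1 ?oner_eq0 ?divr1.
have [[p q] /= [q0 xE]] := regfrac_repr x.
have [[p' q'] /= [q'0 yE]] := regfrac_repr y.
rewrite (specE q0 xE) (specE q'0 yE) (@specE _ (p * p') (q * q')).
- by rewrite !rmorphM mulf_div.
- by rewrite rmorphM mulf_neq0.
- by rewrite /= xE yE !tofracM mulf_div.
Qed.

HB.instance Definition _ := GRing.isZmodMorphism.Build regfrac L spec spec_zmod.
HB.instance Definition _ := GRing.isMonoidMorphism.Build regfrac L spec spec_monoid.

Lemma map_spec_tofrac m (g : {mpoly A[m]}) (g' : {mpoly regfrac[m]}) :
  map_mpoly regval g' = map_mpoly (@FracField.tofrac A) g ->
  map_mpoly spec g' = map_mpoly chi g.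
Proof.
move=> e; apply/mpolyP => k; rewrite !mcoeff_map_mpoly.
have /= ek := map_mpoly_coef_eq e k.
by rewrite /= (@specE _ (g@_k) 1) ?rmorph1 ?oner_eq0 ?divr1.
Qed.

End RegularFractions.

(** D is the product of the denominators. It is found before L and chi are given, so that one D
    serves Q and C alike. *)
Lemma common_denominator (A : idomainType) (s : seq {fraction A}) :
  exists2 D : A, D != 0 & forall (L : fieldType) (chi : {rmorphism A -> L}),
    chi D != 0 -> forall u, u \in s -> u \in regular chi.
Proof.
elim: s => [|u s [D D0 DP]]; first by exists 1; rewrite ?oner_eq0.
have [p [q [q0 uE]]] : exists p q : A, q != 0 /\ u = p%:F / q%:F.
  elim/quotW: u => -[[p q] /= q0]; exists p, q; split=> //.
  apply/eqP; rewrite -(inj_eq (mulIf (_ : q%:F != 0))) ?tofrac_eq0 //.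
  rewrite divfK ?tofrac_eq0 //; unlock FracField.tofrac.
  rewrite -[X in X == _]pi_mul. apply/eqP/eqmodP => /=.
  by rewrite FracField.equivfE /= !numden_Ratio ?mulr1 ?oner_eq0 //= ?mulr1 // mulrC.
exists (q * D) => [|L chi]; first by rewrite mulf_neq0.
rewrite rmorphM mulf_eq0 negb_or => /andP[chiq chiD] v.
rewrite inE => /orP[/eqP ->|]; last exact: DP.
by apply/regularP; exists p, q.
Qed.

Lemma common_denominator_mpoly (A : idomainType) (J : finType) m
    (F : J -> {mpoly {fraction A}[m]}) :
  exists2 D : A, D != 0 & forall (L : fieldType) (chi : {rmorphism A -> L}),
    chi D != 0 -> forall j e, (F j)@_e \in regular chi.
Proof.
have [D D0 DP] := common_denominator (flatten [seq [seq (F j)@_e | e <- msupp (F j)] | j : J]).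
exists D => // L chi chiD j e.
case: (boolP (e \in msupp (F j))) => [em|/memN_msupp_eq0 ->].
  apply: (DP _ _ chiD); apply/flattenP; exists [seq (F j)@_e | e <- msupp (F j)].
    by apply/mapP; exists j; rewrite ?mem_enum.
  by apply/mapP; exists e.
by apply/regularP; exists 0, 1; rewrite rmorph1 oner_eq0 tofrac0 mul0r.
Qed.

(** * Transfer of a basis of the quotient along a specialisation *)

Section LinearExtension.
Variables (n : nat) (R : comNzRingType) (w : 'X_{1..n} -> R).

Definition mlinext (p : {mpoly R[n]}) : R := \sum_(m <- msupp p) p@_m * w m.

Lemma mlinextE k p : (msize p <= k)%N ->
  mlinext p = \sum_(m : 'X_{1..n < k}) p@_m * w m.
Proof.
move=> le_pk; set I : subFinType _ := 'X_{1..n < k}.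
rewrite /mlinext (big_mksub I) ?msupp_uniq //=; first last.
  by move=> x /msize_mdeg_lt /leq_trans; apply.
by rewrite big_rmcond //= => j /memN_msupp_eq0 ->; rewrite mul0r.
Qed.

Lemma mlinext_zmod : zmod_morphism mlinext.
Proof.
move=> p q; pose k := maxn (msize (p - q)) (maxn (msize p) (msize q)).
rewrite !(@mlinextE k) ?leq_max ?leqnn ?orbT // -sumrB.
by apply: eq_bigr => m _; rewrite mcoeffB mulrBl.
Qed.

HB.instance Definition _ :=
  GRing.isZmodMorphism.Build {mpoly R[n]} R mlinext mlinext_zmod.

Lemma mlinextZ c p : mlinext (c *: p) = c * mlinext p.
Proof.
pose k := maxn (msize (c *: p)) (msize p).
rewrite !(@mlinextE k) ?leq_max ?leqnn ?orbT // mulr_sumr.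
by apply: eq_bigr => m _; rewrite mcoeffZ mulrA.
Qed.

Lemma mlinextX m : mlinext 'X_[m] = w m.
Proof. by rewrite /mlinext msuppX big_seq1 mcoeffX eqxx mul1r. Qed.

End LinearExtension.

(** Every monomial is reached from 1 by multiplications by variables. This reduces a claim on all
    polynomials, such as spanning, to the finitely many identities [one_red] and [X_red] below. *)
Lemma mpoly_stable (R : comNzRingType) n (V : {mpoly R[n]} -> Prop) :
  V 0 -> (forall p q, V p -> V q -> V (p + q)) -> (forall c p, V p -> V (c *: p)) ->
  (forall j p, V p -> V ('X_j * p)) -> V 1 -> forall p, V p.
Proof.
move=> V0 VD VZ VX V1; suff VM m : V 'X_[m].
  by elim/mpolyind => // c m p _ _ Vp; apply: VD => //; apply: VZ.
rewrite mpolyXE_id.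
suff Vprod p : V p -> V (\prod_(j < n) 'X_j ^+ m j * p).
  by rewrite -[X in V X]mulr1; apply: Vprod.
move: p; apply: (big_ind (fun q => forall p, V p -> V (q * p))) => [p|p q hp hq r Vr|j _ p Vp].
- by rewrite mul1r.
- by rewrite -mulrA; apply/hp/hq.
- elim: (m j) => [|k IHk]; first by rewrite mul1r.
  by rewrite exprS -mulrA; apply: VX.
Qed.

Lemma cong_meval (R : comNzRingType) m (I : {mpoly R[m]} -> Prop) (v : 'I_m -> R) p :
  is_ideal I ->
  (forall j, I ('X_j - (v j)%:MP)) -> I (p - p.@[v]%:MP).
Proof.
move=> idI Iv; elim/mpolyind: p => [|c e p _ _ IHp].
  by rewrite meval0 mpolyC0 subrr; apply: ideal_0.
rewrite mevalD mpolyCD opprD addrACA; apply: (ideal_D idI) => //.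
rewrite mevalZ mpolyCM -mul_mpolyC; apply: (congM idI); first exact: cong_refl.
rewrite mevalX mpolyXE_id rmorph_prod /=; apply: (cong_prod idI) => j _.
by rewrite rmorphXn /=; apply: (congX idI).
Qed.

Definition gens_at (O : nzRingType) (F : fieldType) (s : O -> F) (T : Type) m
    (G : T -> {mpoly O[m]}) (q : {mpoly F[m]}) : Prop :=
  exists t, q = map_mpoly s (G t).

(** Terms with the same generator are collected, so membership is certified by one cofactor per
    generator, which leaves finitely many fractions to clear. *)
Lemma ideal_of_finite (F : fieldType) m (T : finType) (G : T -> {mpoly F[m]}) p :
  ideal_of (fun q => exists t, q = G t) p ->
  exists h : T -> {mpoly F[m]}, p = \sum_t h t * G t.
Proof.
apply: (@ideal_of_min _ _ _ (fun p => exists h : T -> {mpoly F[m]}, p = \sum_t h t * G t)).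
  split.
  - by exists (fun=> 0); rewrite big1 // => t _; rewrite mul0r.
  - move=> _ _ [h ->] [h' ->]; exists (fun t => h t + h' t).
    by rewrite -big_split; apply: eq_bigr => t _; rewrite mulrDl.
  - move=> q _ [h ->]; exists (fun t => q * h t).
    by rewrite mulr_sumr; apply: eq_bigr => t _; rewrite mulrA.
move=> _ [t ->]; exists (fun t' => (t' == t)%:R).
rewrite (bigD1 t) //= eqxx mul1r big1 ?addr0 // => t' /negPf ->.
by rewrite mul0r.
Qed.

Section Transfer.
Variables (O : comNzRingType) (T : finType) (m N : nat).
Variables (G : T -> {mpoly O[m]}) (b : 'I_N -> {mpoly O[m]}).
Variables (c1 : 'I_N -> O) (cX : 'I_m -> 'I_N -> 'I_N -> O).
Variables (h1 : T -> {mpoly O[m]}) (hX : 'I_m -> 'I_N -> T -> {mpoly O[m]}).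
Hypothesis one_red : 1 - \sum_k c1 k *: b k = \sum_t h1 t * G t.
Hypothesis X_red : forall j k,
  'X_j * b k - \sum_l cX j k l *: b l = \sum_t hX j k t * G t.

Lemma gens_at_combination (F : fieldType) (s : {rmorphism O -> F}) (h : T -> {mpoly O[m]}) :
  ideal_of (gens_at s G) (map_mpoly s (\sum_t h t * G t)).
Proof.
have idI := ideal_of_is_ideal (gens_at s G).
rewrite rmorph_sum; apply: ideal_sum => // t _; rewrite rmorphM.
by apply: ideal_Ml => //; apply: ideal_of_gen; exists t.
Qed.

(** The span of b contains 1 by [one_red] and is stable under each variable by [X_red]; these
    identities over O survive every s. *)
Lemma spanning_at (F : fieldType) (s : {rmorphism O -> F}) :
  spanning (ideal_of (gens_at s G)) (fun k => map_mpoly s (b k)).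
Proof.
have idI := ideal_of_is_ideal (gens_at s G).
apply: mpoly_stable.
- exists (fun=> 0); rewrite big1 ?subrr; first exact: ideal_0.
  by move=> k _; rewrite scale0r.
- move=> p q [c cP] [d dP]; exists (fun k => c k + d k).
  have := ideal_D idI cP dP; rewrite addrACA -opprD -big_split.
  by congr (ideal_of _ (_ - _)); apply: eq_bigr => k _; rewrite scalerDl.
- move=> a p [c cP]; exists (fun k => a * c k).
  have := ideal_Z a idI cP; rewrite scalerBr scaler_sumr.
  by congr (ideal_of _ (_ - _)); apply: eq_bigr => k _; rewrite scalerA.
- move=> j p [c cP]; exists (fun l => \sum_k c k * s (cX j k l)).
  apply: (cong_trans idI (q := \sum_k c k *: ('X_j * map_mpoly s (b k)))).
    have := ideal_Ml idI 'X_j cP; rewrite mulrBr mulr_sumr.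
    by congr (ideal_of _ (_ - _)); apply: eq_bigr => k _; rewrite scalerAr.
  rewrite [X in _ - X](_ : _ = \sum_k c k *: \sum_l s (cX j k l) *: map_mpoly s (b l)).
    apply: cong_sum => // k _; apply: congZ => //.
    have := gens_at_combination s (hX j k); rewrite -X_red rmorphB rmorphM /=.
    rewrite map_mpolyX rmorph_sum /=; congr (ideal_of _ (_ - _)).
    by apply: eq_bigr => l _; rewrite map_mpolyZ.
  under [RHS]eq_bigr do rewrite scaler_sumr.
  rewrite exchange_big /=; apply: eq_bigr => l _; rewrite scaler_suml.
  by apply: eq_bigr => k _; rewrite scalerA.
- exists (fun k => s (c1 k)).
  have := gens_at_combination s h1; rewrite -one_red rmorphB rmorph1 /=.
  rewrite rmorph_sum /=; congr (ideal_of _ (_ - _)).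
  by apply: eq_bigr => l _; rewrite map_mpolyZ.
Qed.

Section Independence.
Variables (K L : fieldType) (v : {rmorphism O -> K}) (s : {rmorphism O -> L}).
Hypothesis v_inj : injective v.
Hypothesis ind : independent (ideal_of (gens_at v G)) (fun k => map_mpoly v (b k)).

Let I := ideal_of (gens_at v G).
Let idI : is_ideal I := ideal_of_is_ideal _.

Lemma coordinates : exists co : {mpoly K[m]} -> 'I_N -> K,
  [/\ forall p c, I (p - \sum_k c k *: map_mpoly v (b k)) -> co p =1 c &
      forall p, I (p - \sum_k co p k *: map_mpoly v (b k))].
Proof.
have [co coP] := choice (spanning_at v).
exists co; split => // p c cP k; apply/eqP; rewrite -subr_eq0; apply/eqP.
apply: (ind (c := fun k => co p k - c k)).
have := cong_trans idI (cong_sym idI (coP p)) cP; congr (I _).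
by rewrite -sumrB; apply: eq_bigr => l _; rewrite scalerBl.
Qed.

(* The coordinate functions on K[x]/I take values in O on monomials, so they
   specialise to linear forms on L[x]; these kill the specialised ideal. *)
Lemma independent_at : independent (ideal_of (gens_at s G)) (fun k => map_mpoly s (b k)).
Proof.
have [co [coE coP]] := coordinates.
have coD p q k : co (p + q) k = co p k + co q k.
  apply: (coE _ (fun k => co p k + co q k) _ k).
  have := ideal_D idI (coP p) (coP q); rewrite addrACA -opprD -big_split.
  by congr (I (_ - _)); apply: eq_bigr => l _; rewrite scalerDl.
have coZ a p k : co (a *: p) k = a * co p k.
  apply: (coE _ (fun k => a * co p k) _ k).
  have := ideal_Z a idI (coP p); rewrite scalerBr scaler_sumr.
  by congr (I (_ - _)); apply: eq_bigr => l _; rewrite scalerA.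
have coI p k : I p -> co p k = 0.
  move=> Ip; apply: (coE _ (fun=> 0) _ k).
  by rewrite big1 ?subr0 // => l _; rewrite scale0r.
have co_sum (J : Type) (r : seq J) (F : J -> {mpoly K[m]}) k :
    co (\sum_(j <- r) F j) k = \sum_(j <- r) co (F j) k.
  elim: r => [|j r IHr]; first by rewrite !big_nil coI //; apply: ideal_0.
  by rewrite !big_cons coD IHr.
have cob l k : co (map_mpoly v (b l)) k = (k == l)%:R.
  apply: (coE _ (fun k => (k == l)%:R) _ k).
  rewrite (bigD1 l) //= eqxx scale1r big1 ?addr0 ?subrr; first exact: ideal_0.
  by move=> i /negPf ->; rewrite scale0r.
have coX j k l : co ('X_j * map_mpoly v (b k)) l = v (cX j k l).
  apply: (coE _ (fun l => v (cX j k l)) _ l).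
  have := gens_at_combination v (hX j k); rewrite -X_red rmorphB rmorphM /=.
  rewrite map_mpolyX rmorph_sum /=; congr (I (_ - _)).
  by apply: eq_bigr => i _; rewrite map_mpolyZ.
(* Coordinates of polynomials over O lie in O: those of 1 are [c1], and multiplication by a variable
   acts on them through [cX]. *)
have coO (p : {mpoly O[m]}) : exists c : 'I_N -> O, forall k, v (c k) = co (map_mpoly v p) k.
  move: p; apply: mpoly_stable => [|p q [c cE] [d dE]|a p [c cE]|j p [c cE]|]; rewrite /=.
  - by exists (fun=> 0) => k; rewrite !rmorph0 coI //; apply: ideal_0.
  - by exists (fun k => c k + d k) => k; rewrite rmorphD cE dE rmorphD coD.
  - by exists (fun k => a * c k) => k; rewrite rmorphM cE map_mpolyZ coZ.
  - exists (fun l => \sum_k c k * cX j k l) => l.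
    rewrite rmorph_sum rmorphM /= map_mpolyX; apply/esym.
    transitivity (co (\sum_k v (c k) *: ('X_j * map_mpoly v (b k))) l).
      apply/eqP; rewrite -subr_eq0 -[- _]mulN1r -coZ -coD scaleN1r coI //.
      have := ideal_Ml idI 'X_j (coP (map_mpoly v p)); rewrite mulrBr.
      by congr (I (_ - _)); rewrite mulr_sumr; apply: eq_bigr => k _; rewrite cE scalerAr.
    by rewrite co_sum; apply: eq_bigr => k _; rewrite coZ coX rmorphM.
  - exists c1 => k; rewrite rmorph1; apply/esym; apply: (coE _ (fun k => v (c1 k)) _ k).
    have := gens_at_combination v h1; rewrite -one_red rmorphB rmorph1 /=.
    rewrite rmorph_sum /=; congr (I (_ - _)).
    by apply: eq_bigr => l _; rewrite map_mpolyZ.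
have [w wE] := choice coO.
pose nu k := mlinext (fun e => s (w 'X_[e] k)).
have nuE k p : nu k (map_mpoly s p) = s (w p k).
  elim/mpolyind: p => [|a e p _ _ IHp].
    have -> : w 0 k = 0 by apply: v_inj; rewrite wE !rmorph0 coI //; apply: ideal_0.
    by rewrite !rmorph0 /nu raddf0.
  rewrite [map_mpoly s _]rmorphD /= map_mpolyZ map_mpolyX /nu raddfD /= mlinextZ mlinextX -/(nu k) IHp.
  rewrite -rmorphM -rmorphD; congr (s _); apply: v_inj.
  by rewrite rmorphD rmorphM !wE rmorphD /= map_mpolyZ coD coZ.
(* A monomial times [G t] has zero coordinates over K, hence in O by injectivity of v, hence after
   s. *)
have nuI k p : ideal_of (gens_at s G) p -> nu k p = 0.
  move=> [M [h [g [gG ->]]]]; rewrite /nu raddf_sum /= big1 // => i _.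
  have [t ->] := gG i; elim/mpolyind: (h i) => [|a e q _ _ IHq].
    by rewrite mul0r raddf0.
  rewrite mulrDl raddfD /= IHq addr0 -scalerAl mlinextZ.
  rewrite -(map_mpolyX s) -rmorphM /= -/(nu k) nuE (_ : w _ k = 0) ?rmorph0 ?mulr0 //.
  apply: v_inj; rewrite wE rmorph0 coI // rmorphM.
  by apply: ideal_Ml => //; apply: ideal_of_gen; exists t.
move=> c Ic k; have := nuI k _ Ic.
rewrite /nu raddf_sum /= (bigD1 k) //= mlinextZ -/(nu k) nuE.
rewrite (_ : w (b k) k = 1) ?rmorph1 ?mulr1; last first.
  by apply: v_inj; rewrite wE rmorph1 cob eqxx.
rewrite big1 ?addr0 // => l lk; rewrite /nu mlinextZ -/(nu k) nuE.
rewrite (_ : w (b l) k = 0) ?rmorph0 ?mulr0 //.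
by apply: v_inj; rewrite wE rmorph0 cob eq_sym (negPf lk).
Qed.

End Independence.
End Transfer.

Lemma mpoly_lift (O K : nzRingType) (v : {rmorphism O -> K}) m (p : {mpoly K[m]}) :
  (forall e, exists c, v c = p@_e) -> exists p' : {mpoly O[m]}, map_mpoly v p' = p.
Proof.
move=> /choice[c cE]; exists (\sum_(e <- msupp p) c e *: 'X_[e]).
rewrite [RHS]mpolyE raddf_sum /=; apply: eq_bigr => e _.
by rewrite map_mpolyZ map_mpolyX cE.
Qed.

Lemma map_mpoly_inj (O K : nzRingType) (v : {rmorphism O -> K}) m :
  injective v -> injective (@map_mpoly m O K v).
Proof.
by move=> v_inj p q pq; apply/mpolyP => e; apply: v_inj; rewrite -!mcoeff_map_mpoly pq.
Qed.

(** Finitely many fractions describe the basis, the coordinates of 1, the structure constants and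
    the cofactors proving these identities. Where D does not vanish they all lie in [regfrac chi],
    which embeds in the fraction field and maps to L, so the transfer lemmas apply. *)
Lemma quot_dim_specialize (A : idomainType) (T : finType) m (G : T -> {mpoly A[m]}) N :
  quot_dim (ideal_of (gens_at (@FracField.tofrac A) G)) N ->
  exists2 D : A, D != 0 & forall (L : fieldType) (chi : {rmorphism A -> L}),
    chi D != 0 -> quot_dim (ideal_of (gens_at chi G)) N.
Proof.
move=> [b [ind spn]].
have idI := ideal_of_is_ideal (gens_at (@FracField.tofrac A) G).
have [c1 /ideal_of_finite[h1 h1E]] := spn 1.
have [cX cXP] := choice (fun jk : 'I_m * 'I_N => spn ('X_(jk.1) * b jk.2)).
have [hX hXE] := choice (fun jk => ideal_of_finite (cXP jk)).
(* Scalars are wrapped as constant polynomials so that one denominator lemma covers them too. *)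
pose C (c : {fraction A}) : {mpoly {fraction A}[m]} := c%:MP.
have [D1 D10 D1P] := common_denominator_mpoly b.
have [D2 D20 D2P] := common_denominator_mpoly (fun k => C (c1 k)).
have [D3 D30 D3P] := common_denominator_mpoly h1.
have [D4 D40 D4P] := common_denominator_mpoly (fun t : 'I_m * 'I_N * 'I_N => C (cX t.1 t.2)).
have [D5 D50 D5P] := common_denominator_mpoly (fun t : 'I_m * 'I_N * T => hX t.1 t.2).
exists (D1 * D2 * D3 * D4 * D5) => [|L chi]; first by rewrite !mulf_neq0.
rewrite !rmorphM !mulf_eq0 !negb_or => /andP[/andP[/andP[/andP[r1 r2] r3] r4] r5].
pose O := regfrac chi; pose v : {rmorphism O -> {fraction A}} := @regval _ _ chi.
pose s : {rmorphism O -> L} := @spec _ _ chi.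
have v_inj : injective v by apply: val_inj.
have liftc u : u \in regular chi -> exists c, v c = u.
  by move=> ru; exists (RegFrac ru).
have [b' b'E] := choice (fun k => mpoly_lift (fun e => liftc _ (D1P _ _ r1 k e))).
have [h1' h1'E] := choice (fun t => mpoly_lift (fun e => liftc _ (D3P _ _ r3 t e))).
have [hX' hX'E] := choice (fun t => mpoly_lift (fun e => liftc _ (D5P _ _ r5 t e))).
have rC J (F : J -> {fraction A}) j :
    (forall i e, (C (F i))@_e \in regular chi) -> exists c, v c = F j.
  by move=> r; apply: liftc; have := r j 0%MM; rewrite mcoeffC eqxx mulr1.
have [c1' c1'E] := choice (fun k => rC _ _ k (D2P _ _ r2)).
have [cX' cX'E] := choice (fun t => rC _ (fun t => cX t.1 t.2) t (D4P _ _ r4)).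
have rG t e : (map_mpoly (@FracField.tofrac A) (G t))@_e \in regular chi.
  rewrite mcoeff_map_mpoly; apply/regularP.
  by exists (G t)@_e, 1; rewrite rmorph1 oner_eq0 tofrac1 divr1.
have [G' G'E] := choice (fun t => mpoly_lift (fun e => liftc _ (rG t e))).
have sG t : map_mpoly s (G' t) = map_mpoly chi (G t) by apply: map_spec_tofrac.
have one_red : 1 - \sum_k c1' k *: b' k = \sum_t h1' t * G' t.
  apply: (map_mpoly_inj v_inj); rewrite rmorphB rmorph1 !rmorph_sum /=.
  rewrite [RHS](_ : _ = \sum_t h1 t * map_mpoly (@FracField.tofrac A) (G t)); last first.
    by apply: eq_bigr => t _; rewrite rmorphM /= h1'E G'E.
  rewrite -h1E; congr (_ - _); apply: eq_bigr => k _.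
  by rewrite map_mpolyZ b'E c1'E.
have X_red j k : 'X_j * b' k - \sum_l cX' (j, k, l) *: b' l = \sum_t hX' (j, k, t) * G' t.
  apply: (map_mpoly_inj v_inj); rewrite rmorphB rmorphM !rmorph_sum /= map_mpolyX b'E.
  rewrite [RHS](_ : _ = \sum_t hX (j, k) t * map_mpoly (@FracField.tofrac A) (G t)); last first.
    by apply: eq_bigr => t _; rewrite rmorphM /= hX'E G'E.
  rewrite -hXE; congr (_ - _); apply: eq_bigr => l _.
  by rewrite map_mpolyZ b'E cX'E.
have eqgens (F : fieldType) (f : O -> F) (g : A -> F) :
    (forall t, map_mpoly f (G' t) = map_mpoly g (G t)) -> gens_at f G' = gens_at g G.
  move=> fg; apply/funext => q; apply/propext.
  by split=> -[t ->]; exists t; rewrite fg.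
rewrite -(eqgens _ s) //; exists (fun k => map_mpoly s (b' k)); split.
  apply: (independent_at one_red X_red v_inj).
  rewrite (eqgens _ _ _ G'E).
  by rewrite (_ : (fun k => _) = b) //; apply/funext => k; apply: b'E.
exact: (spanning_at one_red X_red).
Qed.

(** * Finiteness of the generic fibre *)

Lemma quot_dim_spanning_fin (K : fieldType) m (I : {mpoly K[m]} -> Prop) (J : finType)
    (g : J -> {mpoly K[m]}) :
  is_ideal I -> (forall p, exists c : J -> K, I (p - \sum_j c j *: g j)) ->
  exists N, quot_dim I N.
Proof.
move=> idI spn.
have [p|N qN _] := @quot_dim_spanning _ _ I _ (fun k : 'I_#|J| => g (enum_val k)) idI.
  have [c cP] := spn p; exists (fun k => c (enum_val k)).
  by move: cP; rewrite (reindex (@enum_val J predT)) //; apply/onW_bij/enum_val_bij.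
by exists N.
Qed.

(** Division by the relation of X_j rewrites each power of X_j through powers below d, so the
    monomials with all exponents below d span. *)
Lemma quot_dim_algebraic (K : fieldType) m (I : {mpoly K[m]} -> Prop) :
  is_ideal I ->
  (forall j, exists2 p : {poly K}, p != 0 & I (map_poly (@mpolyC m K) p).['X_j]) ->
  exists N, quot_dim I N.
Proof.
move=> idI alg.
have [P PP] := choice (fun j => let: ex_intro2 p p0 Ip := alg j in
  ex_intro (fun p => p != 0 /\ I (map_poly (@mpolyC m K) p).['X_j]) p (conj p0 Ip)).
pose d := \max_j size (P j).
pose mon (f : {ffun 'I_m -> 'I_d}) : {mpoly K[m]} := \prod_j 'X_j ^+ f j.
have powX j k : exists c : 'I_d -> K, I ('X_j ^+ k - \sum_(i < d) c i *: 'X_j ^+ i).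
  have [Pj0 IPj] := PP j; exists (fun i => ('X^k %% P j)`_i).
  have := ideal_Ml idI (map_poly (@mpolyC m K) ('X^k %/ P j)).['X_j] IPj.
  rewrite -hornerM -rmorphM; congr (I _).
  have /(canRL (addrK _)) -> := esym (divp_eq 'X^k (P j)).
  rewrite rmorphB hornerD hornerN rmorphXn /= map_polyX hornerXn; congr (_ - _).
  rewrite (@horner_coef_wide _ d); last first.
    apply: leq_trans (size_poly _ _) _; apply: leq_trans (ltnW _) (leq_bigmax j).
    by rewrite ltn_modp.
  by apply: eq_bigr => i _; rewrite coef_map /= mul_mpolyC.
apply: (@quot_dim_spanning_fin _ _ I _ mon) => //.
elim/mpolyind => [|a e p _ _ [c cP]].
  exists (fun=> 0); rewrite big1 ?subrr; first exact: ideal_0.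
  by move=> f _; rewrite scale0r.
have [u uP] := choice (fun j => powX j (e j)).
exists (fun f : {ffun 'I_m -> 'I_d} => a * \prod_j u j (f j) + c f).
rewrite (eq_bigr (fun f : {ffun 'I_m -> 'I_d} => a *: ((\prod_j u j (f j)) *: mon f) + c f *: mon f)); last first.
  by move=> f _; rewrite scalerDl scalerA.
rewrite big_split /= opprD addrACA; apply: ideal_D => //.
rewrite -scaler_sumr; apply: congZ => //; rewrite mpolyXE_id.
rewrite (eq_bigr (fun f : {ffun 'I_m -> 'I_d} => \prod_j (u j (f j) *: 'X_j ^+ f j))); last first.
  by move=> f _; rewrite scaler_prod.
rewrite -(bigA_distr_bigA (fun j (i : 'I_d) => u j i *: 'X_j ^+ i : {mpoly K[m]})).
by apply: cong_prod => // j _; apply: uP.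
Qed.

(** * Algebraic dependence by counting monomials *)

Section DegreeBound.
Variables (F : fieldType) (n : nat).
Implicit Types p q : {mpoly F[n]}.

(** [msize] is the total degree plus one, and 0 for the zero polynomial; a degree at most k
    therefore reads [msize p <= k.+1]. *)
Lemma msizeM_bound k l p q :
  (msize p <= k.+1)%N -> (msize q <= l.+1)%N -> (msize (p * q) <= (k + l).+1)%N.
Proof.
move=> pk ql; have [->|p0] := eqVneq p 0; first by rewrite mul0r msize0.
have [->|q0] := eqVneq q 0; first by rewrite mulr0 msize0.
by rewrite msizeM // -subn1 leq_subLR (leq_trans (leq_add pk ql)) // addSn addnS.
Qed.

Lemma msizeX_bound k l p : (msize p <= k.+1)%N -> (msize (p ^+ l) <= (k * l).+1)%N.
Proof.
move=> pk; elim: l => [|l IHl]; first by rewrite msize1.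
by rewrite exprS mulnS; apply: msizeM_bound.
Qed.

Lemma msize_prod_bound (J : finType) (P : J -> {mpoly F[n]}) (k : J -> nat) :
  (forall j, msize (P j) <= (k j).+1)%N -> (msize (\prod_j P j) <= (\sum_j k j).+1)%N.
Proof.
move=> Pk; apply: (big_ind2 (fun p k => msize p <= k.+1)%N) => //.
- by rewrite msize1.
- by move=> *; apply: msizeM_bound.
Qed.

(** All exponents of the Q_j are below b, so the Q_j live in a space of dimension b^n, spanned by a
    box of monomials. *)
Lemma dependent_of_msize (J : finType) (Q : J -> {mpoly F[n]}) b :
  (forall j, msize (Q j) <= b)%N -> (b ^ n < #|J|)%N ->
  exists2 v : J -> F, (exists j, v j != 0) & \sum_j v j *: Q j = 0.
Proof.
move=> Qb ltbJ; pose B : finType := {ffun 'I_n -> 'I_b}.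
pose mon (f : B) : 'X_{1..n} := [multinom (f i : nat) | i < n].
pose A := \matrix_(j < #|J|, f < #|B|) (Q (enum_val j))@_(mon (enum_val f)).
have [v v0 vA] : exists2 v : 'rV_#|J|, v != 0 & v *m A = 0.
  by apply: wide_kernel; rewrite card_ffun !card_ord.
exists (fun j => v 0 (enum_rank j)).
  have [j vj] : exists j, v 0 j != 0.
    apply/existsP; rewrite -negb_forall; apply: contra v0 => /forallP h.
    by apply/eqP/rowP => j; rewrite mxE; apply/eqP.
  by exists (enum_val j); rewrite enum_valK.
apply/mpolyP => e; rewrite mcoeff0 raddf_sum /=.
have [eb|] := boolP [forall i, e i < b]%N.
  pose f : B := [ffun i => Ordinal (forallP eb i)].
  have -> : e = mon f by apply/mnmP => i; rewrite mnmE ffunE.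
  transitivity ((v *m A) 0 (enum_rank f)); last by rewrite vA mxE.
  rewrite mxE (reindex (@enum_val J predT)); last exact/onW_bij/enum_val_bij.
  by apply: eq_bigr => j _; rewrite mcoeffZ mxE enum_valK enum_rankK.
rewrite negb_forall; case/existsP => i; rewrite -leqNgt => bi.
apply: big1 => j _; rewrite mcoeffZ memN_msupp_eq0 ?mulr0 //.
apply: msize_mdeg_ge; apply: leq_trans (Qb j) _; apply: leq_trans bi _.
by rewrite mdegE (bigD1 i) //= leq_addr.
Qed.

End DegreeBound.

(** Up to the denominator w, the n + 1 elements a_1, .., a_n, y are polynomials in the n elements z.
    Their monomials with exponents at most D number (D+1)^(n+1); multiplied by w^e with e = (n+1)D,
    they become polynomials in z of degree at most ce. Those form a space of dimension at most
    (ce+1)^n, which is smaller for large D. *)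
Lemma algebraic_dependence (F : fieldType) n (E : comNzRingType) (phi : {rmorphism F -> E})
    (I : E -> Prop) (z a : 'I_n -> E) (y w : E) (W qy : {mpoly F[n]})
    (q : 'I_n -> {mpoly F[n]}) :
  is_ideal I -> I (w - mmap phi z W) -> (forall t, I (w * a t - mmap phi z (q t))) ->
  I (w * y - mmap phi z qy) ->
  exists (P : {poly {mpoly F[n]}}) e,
    P != 0 /\ I (w ^+ e * (map_poly (mmap phi a) P).[y]).
Proof.
move=> idI wW aq yq.
pose c := maxn (msize W) (maxn (msize qy) (\max_t msize (q t))).
have Wc : (msize W <= c.+1)%N by rewrite leqW // leq_maxl.
have yc : (msize qy <= c.+1)%N by rewrite leqW // !leq_max leqnn orbT.
have qc t : (msize (q t) <= c.+1)%N.
  by rewrite leqW // !leq_max (leq_bigmax t) !orbT.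
(* Since ce + 1 is at most (c(n+1) + 1)(D + 1), the count succeeds as soon as D + 1 exceeds (c(n+1)
   + 1)^n. *)
have [D ltD] : exists D, ((c * n.+1).+1 ^ n < D.+1)%N by exists ((c * n.+1).+1 ^ n)%N.
have [e eE] : exists e, e = (D + n * D)%N by exists (D + n * D)%N.
pose J : finType := ({ffun 'I_n -> 'I_D.+1} * 'I_D.+1)%type.
pose deg (j : J) := (\sum_t j.1 t + j.2)%N.
have dege j : (deg j <= e)%N.
  rewrite /deg eE addnC leq_add //; first by rewrite -ltnS ltn_ord.
  rewrite -[n in (n * D)%N]card_ord -sum_nat_const; apply: leq_sum => t _.
  by rewrite -ltnS ltn_ord.
pose Q (j : J) := W ^+ (e - deg j) * ((\prod_t q t ^+ j.1 t) * qy ^+ j.2).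
pose mon (j : J) := (\prod_t a t ^+ j.1 t) * y ^+ j.2.
have QE j : I (w ^+ e * mon j - mmap phi z (Q j)).
  rewrite -[in w ^+ e](subnK (dege j)) exprD !rmorphM rmorph_prod rmorphXn /= -mulrA.
  apply: congM => //; first exact: congX.
  (* The power w^(deg j) is shared out among the deg j factors of [mon j], each of which becomes a
     polynomial in z. *)
  rewrite exprD -prodrXr mulrACA -big_split -exprMn rmorphXn /=.
  apply: congM => //; last exact: congX.
  apply: cong_prod => // t _; rewrite -exprMn rmorphXn /=.
  exact: congX.
have Qb j : (msize (Q j) <= (c * e).+1)%N.
  rewrite -[in e](subnK (dege j)) mulnDr [(c * deg j)%N]mulnDr big_distrr /=.
  apply: msizeM_bound; first exact: msizeX_bound.
  apply: msizeM_bound; last exact: msizeX_bound.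
  by apply: msize_prod_bound => t; apply: msizeX_bound.
have [|v [j0 vj0] vQ] := dependent_of_msize Qb.
  rewrite card_prod card_ffun !card_ord -expnSr.
  have h : ((c * e).+1 <= (c * n.+1).+1 * D.+1)%N.
    rewrite eE -mulSn mulnA; move: (c * n.+1)%N => x.
    by rewrite mulSn mulnS addSn ltnS addnA leq_addl.
  apply: (@leq_ltn_trans (((c * n.+1).+1 * D.+1) ^ n)%N).
    have leX u u' k : (u <= u' -> u ^ k <= u' ^ k)%N by case: k => // k; rewrite leq_exp2r.
    exact: leX.
  by rewrite expnMn expnS ltn_mul2r ltD expn_gt0.
pose X (j : J) : 'X_{1..n} := [multinom (j.1 t : nat) | t < n].
exists (\sum_j (v j *: 'X_[X j]) *: 'X^(j.2)), e; split.
  (* Distinct j give distinct monomials, so the coefficient at j0 is exactly [v j0]. *)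
  apply/eqP => /(congr1 (fun P : {poly {mpoly F[n]}} => P`_(j0.2)@_(X j0))).
  rewrite coef0 mcoeff0 coef_sum raddf_sum (bigD1 j0) //= coefZ coefXn eqxx mulr1.
  rewrite mcoeffZ mcoeffX eqxx mulr1 big1 ?addr0 => [/eqP|j jj0]; first exact/negP.
  rewrite coefZ coefXn; case: eqP => [e2|_]; last by rewrite mulr0 mcoeff0.
  rewrite mulr1 mcoeffZ mcoeffX; case: eqP => [e1|_]; last by rewrite mulr0.
  case/eqP: jj0; case: j j0 e1 e2 {vj0} => [j1 j2] [k1 k2] /= /mnmP e1 /val_inj ->.
  congr (_, _); apply/ffunP => t; apply: val_inj.
  by have := e1 t; rewrite !mnmE.
have -> : w ^+ e * (map_poly (mmap phi a) (\sum_j (v j *: 'X_[X j]) *: 'X^(j.2))).[y]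
    = \sum_j phi (v j) * (w ^+ e * mon j).
  rewrite rmorph_sum horner_sum mulr_sumr; apply: eq_bigr => j _ /=.
  rewrite map_polyZ map_polyXn hornerZ hornerXn /= mmapZ mmapX -mulrA mulrCA.
  by congr (_ * (_ * (_ * _))); apply: eq_bigr => t _; rewrite mnmE.
have := congr1 (mmap phi z) vQ; rewrite rmorph0 rmorph_sum /= => vQ0.
rewrite -[X in I X]subr0 -[X in _ - X]vQ0; apply: cong_sum => // j _.
by rewrite mmapZ; apply: congM => //; apply: cong_refl.
Qed.
Section Comaximal.
Variables (E : comNzRingType) (I : E -> Prop).
Hypothesis idI : is_ideal I.

Lemma ideal_exprD x y a b : I (x ^+ a) -> I (y ^+ b) -> I ((x + y) ^+ (a + b)).
Proof.
move=> xa yb; rewrite exprDn; apply: ideal_sum => // k _.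
rewrite -mulr_natr; apply: (ideal_Mr idI).
have [bk|kb] := leqP b k.
  by rewrite -(subnK bk) exprD mulrA; apply: (ideal_Ml idI).
by rewrite -addnBA ?(ltnW kb) // exprD -mulrA; apply: (ideal_Mr idI).
Qed.

Lemma comaximal_powers (J : finType) (u h : J -> E) (k : J -> nat) :
  I (\sum_j h j * u j - 1) -> (forall j, I (u j ^+ k j)) -> I 1.
Proof.
move=> hu uk.
have [K KP] : exists K, I ((\sum_j h j * u j) ^+ K).
  apply: (big_ind (fun x => exists K, I (x ^+ K))).
  - by exists 1%N; rewrite expr1; apply: ideal_0.
  - by move=> x y [a xa] [b yb]; exists (a + b)%N; apply: ideal_exprD.
  - by move=> j _; exists (k j); rewrite exprMn; apply: ideal_Ml.
have := congX idI K hu; rewrite expr1n => h1.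
by have := ideal_B idI KP h1; rewrite subKr.
Qed.

End Comaximal.

(** [comaximal_powers] applied to the colon ideal of p. It allows membership in I to be checked
    chart by chart. *)
Lemma comaximal_cancel (E : comNzRingType) (I : E -> Prop) (J : finType)
    (u h : J -> E) (k : J -> nat) p :
  is_ideal I -> I (\sum_j h j * u j - 1) -> (forall j, I (u j ^+ k j * p)) -> I p.
Proof.
move=> idI hu up; rewrite -[p]mul1r.
apply: (@comaximal_powers _ (fun x => I (x * p)) _ _ u h k) => //; last exact: ideal_Mr.
split=> [|x y xp yp|x y yp]; first by rewrite mul0r; apply: ideal_0.
  by rewrite mulrDl; apply: ideal_D.
by rewrite -mulrA; apply: ideal_Ml.
Qed.

(** * The family of ideals, its charts and its generic member *)

Section Family.
Variables (n r i : nat) (f : 'I_r -> {mpoly rat[n]}).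
Local Notation x j := ('X_(widen_ord (leqnSn n) j)).

(** The generators of [Igens] over any ring of parameters, indexed by a finite type: one formula
    covers indeterminate, rational and complex parameters. *)
Definition igen (B : comNzRingType) (iota : rat -> B) (Th : 'M[B]_(i, n))
    (La : 'M[B]_(n - i, r)) (mu : 'rV[B]_r) (t : 'I_i + 'I_(n - i) + unit) :
    {mpoly B[n.+1]} :=
  match t with
  | inl (inl k) => \sum_j Th k j *: x j - 1
  | inl (inr k) => \sum_j La k j *: map_mpoly iota (liftT (f j))
  | inr _ => 1 - (\sum_j mu 0 j *: map_mpoly iota (liftT (f j))) * 'X_ord_max
  end.

Definition params (B : nzRingType) (Th : 'M[B]_(i, n)) (La : 'M[B]_(n - i, r))
    (mu : 'rV[B]_r) : 'rV[B]_(i * n + (n - i) * r + r) :=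
  row_mx (row_mx (mxvec Th) (mxvec La)) mu.

Section GenericFinite.
Variables (K : fieldType) (phi : {rmorphism rat -> K}).
Variables (Th : 'M[K]_(i, n)) (La : 'M[K]_(n - i, r)) (mu : 'rV[K]_r).
Hypothesis hi : (i < n)%N.
Local Notation P := {mpoly K[n.+1]}.
Local Notation M := (i * n + (n - i) * r + r)%N.

Let I : P -> Prop := ideal_of (fun q => exists t, q = igen phi Th La mu t).
Let idI : is_ideal I := ideal_of_is_ideal _.
Let cst : {rmorphism rat -> P} := @mpolyC n.+1 K \o phi.
Let F s : P := map_mpoly phi (liftT (f s)).
Let u : P := \sum_j mu 0 j *: F j.
Let a : 'I_M -> P := fun t => (params Th La mu 0 t)%:MP.

Let I_Th k : I (\sum_j Th k j *: x j - 1).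
Proof. by apply: ideal_of_gen; exists (inl (inl k)). Qed.

Let I_La k : I (\sum_j La k j *: F j).
Proof. by apply: ideal_of_gen; exists (inl (inr k)). Qed.

Let I_mu : I (1 - u * 'X_ord_max).
Proof. by apply: ideal_of_gen; exists (inr tt). Qed.

Section Chart.
Variables (l : 'I_n) (s : 'I_r).

(* For [i = 0] no affine linear equation is available, and none is needed. *)
Let g : P := if i == 0%N then 1 else x l.
Let w : P := g * F s * u.

(* Where g, F_s and u are invertible, the equations can be solved for the
   parameters Th_kl and La_ks and for T; the freed slots carry x_1, .., x_n. *)
Let z : 'I_M -> P := params
  (\matrix_(k, j) if j == l then x (widen_ord (ltnW hi) k) else (Th k j)%:MP)
  (\matrix_(k, j) if j == s then x (cast_ord (subnKC (ltnW hi)) (rshift i k)) else (La k j)%:MP)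
  (map_mx (@mpolyC n.+1 K) mu) 0.

(** The admissible numerators and denominators. The coefficients are rational, so that the relation
    found by [algebraic_dependence] is one over Q. *)
Let rep (v : P) := exists q : {mpoly rat[M]}, v = mmap cst z q.

Let repD v v' : rep v -> rep v' -> rep (v + v').
Proof. by move=> [q ->] [q' ->]; exists (q + q'); rewrite mmapD. Qed.

Let repM v v' : rep v -> rep v' -> rep (v * v').
Proof. by move=> [q ->] [q' ->]; exists (q * q'); rewrite rmorphM. Qed.

Let repC c : rep (cst c).
Proof. by exists c%:MP; rewrite mmapC. Qed.

Let rep0 : rep 0. Proof. by exists 0; rewrite mmap0. Qed.
Let rep1 : rep 1. Proof. by exists 1; rewrite rmorph1. Qed.

Let repN v : rep v -> rep (- v).
Proof. by move=> [q ->]; exists (- q); rewrite mmapN. Qed.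

Let rep_sum (J : finType) (Q : pred J) (v : J -> P) :
  (forall j, Q j -> rep (v j)) -> rep (\sum_(j | Q j) v j).
Proof. by move=> h; apply: big_ind. Qed.

Let rep_prod (J : finType) (v : J -> P) : (forall j, rep (v j)) -> rep (\prod_j v j).
Proof. by move=> h; apply: big_ind. Qed.

Let repX v k : rep v -> rep (v ^+ k).
Proof. by move=> h; elim: k => [|k IHk]; rewrite ?exprS //; apply: repM. Qed.

Let rep_z t : rep (z t).
Proof. by exists 'X_t; rewrite mmapX mmap1U. Qed.

Let zTh k j : z (lshift r (lshift _ (mxvec_index k j))) =
  if j == l then x (widen_ord (ltnW hi) k) else (Th k j)%:MP.
Proof. by rewrite /z /params row_mxEl row_mxEl mxvecE mxE. Qed.

Let zLa k j : z (lshift r (rshift _ (mxvec_index k j))) =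
  if j == s then x (cast_ord (subnKC (ltnW hi)) (rshift i k)) else (La k j)%:MP.
Proof. by rewrite /z /params row_mxEl row_mxEr mxvecE mxE. Qed.

Let zmu j : z (rshift _ j) = (mu 0 j)%:MP.
Proof. by rewrite /z /params row_mxEr mxE. Qed.

(** The i freed slots in column l of Theta carry x_1, .., x_i, and the n - i freed slots in column s
    of Lambda carry the other variables. *)
Let rep_x j : rep (x j).
Proof.
rewrite -[j](cast_ordKV (subnKC (ltnW hi))).
case: (split_ordP (cast_ord (esym (subnKC (ltnW hi))) j)) => k ->.
  have := rep_z (lshift r (lshift _ (mxvec_index k l))); rewrite zTh eqxx.
  by congr (rep 'X_(widen_ord _ _)); apply: val_inj.
by have := rep_z (lshift r (rshift _ (mxvec_index k s))); rewrite zLa eqxx.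
Qed.

Let rep_F j : rep (F j).
Proof.
rewrite /F /liftT; elim/mpolyind: (f j) => [|c m p _ _ IHp].
  by rewrite !raddf0.
rewrite !raddfD; apply: repD => //.
rewrite /= mmapZ mmapX rmorphM /= map_mpolyC; apply: repM; first exact: repC.
rewrite rmorph_prod; apply: rep_prod => k; rewrite rmorphXn /= map_mpolyX.
exact/repX/rep_x.
Qed.

Let rep_u : rep u.
Proof.
apply: rep_sum => j _; rewrite -mul_mpolyC -zmu; apply: repM => //.
Qed.

Let rep_g : rep g.
Proof. by rewrite /g; case: ifP. Qed.

(** A parameter outside the freed columns is itself some z. For a freed one, the k-th affine
    equation gives Th_kl x_l, and the k-th combination of the F_j gives La_ks F_s; the rest of w is
    carried along as a factor. *)
Let solve_parameter t : exists q, I (w * a t - mmap cst z q).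
Proof.
suff [v [q ->] h] : exists2 v, rep v & I (w * a t - v) by exists q.
have rw : rep w by do !apply: repM.
have triv v : rep v -> a t = v -> exists2 v, rep v & I (w * a t - v).
  by move=> rv ->; exists (w * v); [apply: repM | apply: cong_refl].
case: (split_ordP t) triv => [t' ->|j -> triv]; last first.
  by apply: (triv _ (rep_z (rshift _ j))); rewrite zmu /a /params row_mxEr.
case: (split_ordP t') => {t'} t' ->; case/mxvec_indexP: t' => k j triv.
  have aE : a (lshift r (lshift ((n - i) * r) (mxvec_index k j))) = (Th k j)%:MP.
    by rewrite /a /params !row_mxEl mxvecE.
  have [jl|jl] := eqVneq j l; last first.
    by apply: (triv _ (rep_z _)); rewrite aE; have := zTh k j; rewrite (negPf jl) => <-.
  exists (F s * u * (1 - \sum_(j | j != l) Th k j *: x j)).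
    apply: (repM (repM (rep_F s) rep_u)); apply: repD => //; apply: repN.
    apply: rep_sum => j' j'l; rewrite -mul_mpolyC; apply: repM => //.
    by have := rep_z (lshift r (lshift _ (mxvec_index k j'))); rewrite zTh (negPf j'l).
  have := ideal_Ml idI (F s * u) (I_Th k); rewrite (bigD1 l) //= aE jl /w /g.
  case: eqP => [i0|_]; first by have := ltn_ord k; rewrite [X in (_ < X)%N]i0 ltn0.
  congr (I _); rewrite -mul_mpolyC; ring.
have aE : a (lshift r (rshift (i * n) (mxvec_index k j))) = (La k j)%:MP.
  by rewrite /a /params row_mxEl row_mxEr mxvecE.
have [js|js] := eqVneq j s; last first.
  by apply: (triv _ (rep_z _)); rewrite aE; have := zLa k j; rewrite (negPf js) => <-.
exists (- (g * u * \sum_(j | j != s) La k j *: F j)).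
  apply/repN/(repM (repM rep_g rep_u)); apply: rep_sum => j' j's.
  rewrite -mul_mpolyC; apply: repM => //.
  by have := rep_z (lshift r (rshift _ (mxvec_index k j'))); rewrite zLa (negPf j's).
have := ideal_Ml idI (g * u) (I_La k); rewrite (bigD1 s) //= aE js /w.
congr (I _); rewrite -mul_mpolyC; ring.
Qed.

Let solve_variable (j : 'I_n.+1) : exists q, I (w * 'X_j - mmap cst z q).
Proof.
suff [v [q ->] h] : exists2 v, rep v & I (w * 'X_j - v) by exists q.
have [jn|nj] := ltnP j n.
  have -> : j = widen_ord (leqnSn n) (Ordinal jn) by apply: val_inj.
  by exists (w * x (Ordinal jn)); [do !apply: repM | apply: cong_refl].
have -> : j = ord_max by apply/val_inj/eqP; rewrite eqn_leq nj -ltnS ltn_ord.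
exists (g * F s); first exact: repM.
have := ideal_N idI (ideal_Ml idI (g * F s) I_mu); congr (I _); rewrite /w; ring.
Qed.

(** The relation p is nonzero with formal parameters as coefficients. At special parameters its
    image may vanish; at indeterminate ones it cannot, which is how the lemma is used. *)
Lemma algebraic_on_chart (j : 'I_n.+1) :
  exists (p : {poly {mpoly rat[M]}}) e,
    p != 0 /\ I ((g * F s) ^+ e * (map_poly (mmap cst a) p).['X_j]).
Proof.
have [W WE] : rep w by do !apply: repM.
have [q qP] := choice solve_parameter.
have [qy qyP] := solve_variable j.
have [|p [e [p0 pP]]] := @algebraic_dependence _ _ _ cst I z a 'X_j w W qy q idI _ qP qyP.
  by rewrite WE; apply: cong_refl.
exists p, e; split => //.
(* Multiplication by T^e removes the factor u^e of w^e, because u T is congruent to 1. *)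
have h := ideal_Ml idI ('X_ord_max ^+ e) pP.
have : I ((u * 'X_ord_max) ^+ e - 1).
  by rewrite -[X in _ - X](expr1n _ e); apply: (congX idI); apply: (cong_sym idI).
move/(ideal_Mr idI ((g * F s) ^+ e * (map_poly (mmap cst a) p).['X_j])).
move/(ideal_B idI h); congr (I _); rewrite /w !exprMn; ring.
Qed.

End Chart.
End GenericFinite.
End Family.
Lemma mpoly_rmorphism_mmap (R : nzRingType) (S : comNzRingType) m
    (h : {rmorphism {mpoly R[m]} -> S}) (q : {mpoly R[m]}) :
  mmap (h \o @mpolyC m R) (fun t => h 'X_t) q = h q.
Proof.
rewrite [q in RHS]mpolyE rmorph_sum; apply: eq_bigr => e _.
rewrite -mul_mpolyC rmorphM mpolyXE_id rmorph_prod; congr (_ * _).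
by apply: eq_bigr => t _; rewrite rmorphXn.
Qed.

Lemma map_mpoly_comp_fun (R S U : nzRingType) (g : {rmorphism S -> U}) (h : {rmorphism R -> S})
    m (p : {mpoly R[m]}) :
  map_mpoly g (map_mpoly h p) = map_mpoly (g \o h) p.
Proof. by apply/mpolyP => e; rewrite !mcoeff_map_mpoly. Qed.

Section GenericDimension.
Variables (n r i : nat) (f : 'I_r -> {mpoly rat[n]}).
Hypothesis hi : (i < n)%N.
Local Notation M := (i * n + (n - i) * r + r)%N.
Local Notation A := {mpoly rat[M]}.

Lemma map_igen (B C : comNzRingType) (chi : {rmorphism B -> C}) (iota : {rmorphism rat -> B})
    Th La mu t :
  map_mpoly chi (igen f iota Th La mu t) =
  @igen n r i f C (chi \o iota) (map_mx chi Th) (map_mx chi La) (map_mx chi mu) t.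
Proof.
have mapF j : map_mpoly chi (map_mpoly iota (liftT (f j))) = map_mpoly (chi \o iota) (liftT (f j)).
  exact: map_mpoly_comp_fun.
case: t => [[k|k]|[]] /=.
- rewrite rmorphB rmorph1 rmorph_sum /=; congr (_ - _); apply: eq_bigr => j _.
  by rewrite map_mpolyZ map_mpolyX mxE.
- rewrite rmorph_sum /=; apply: eq_bigr => j _.
  by rewrite map_mpolyZ mapF mxE.
- rewrite rmorphB rmorph1 rmorphM rmorph_sum /= map_mpolyX; congr (_ - _ * _).
  by apply: eq_bigr => j _; rewrite map_mpolyZ mapF mxE.
Qed.

Let ThG : 'M[A]_(i, n) := \matrix_(k, j) 'X_(lshift r (lshift _ (mxvec_index k j))).
Let LaG : 'M[A]_(n - i, r) := \matrix_(k, j) 'X_(lshift r (rshift _ (mxvec_index k j))).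
Let muG : 'rV[A]_r := \row_j 'X_(rshift _ j).

Let params_generic t : params ThG LaG muG 0 t = 'X_t.
Proof.
rewrite /params; case: (split_ordP t) => [t' ->|j ->]; last by rewrite row_mxEr mxE.
rewrite row_mxEl; case: (split_ordP t') => {}t' ->; case/mxvec_indexP: t' => k j.
  by rewrite row_mxEl mxvecE mxE.
by rewrite row_mxEr mxvecE mxE.
Qed.

Let map_params (B C : nzRingType) (chi : B -> C) Th La mu :
  map_mx chi (@params n r i B Th La mu) = params (map_mx chi Th) (map_mx chi La) (map_mx chi mu).
Proof. by rewrite /params !map_row_mx !map_mxvec. Qed.

Let G := igen f (@mpolyC M rat) ThG LaG muG.

Lemma generic_quot_dim : exists N, quot_dim (ideal_of (gens_at (@FracField.tofrac A) G)) N.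
Proof.
set I := ideal_of _; have idI : is_ideal I := ideal_of_is_ideal _.
pose tf : {rmorphism A -> {fraction A}} := @FracField.tofrac A.
pose phi : {rmorphism rat -> {fraction A}} := @FracField.tofrac A \o @mpolyC M rat.
pose Th := map_mx tf ThG; pose La := map_mx tf LaG; pose mu := map_mx tf muG.
have IE : I = ideal_of (fun q => exists t, q = igen f phi Th La mu t).
  congr ideal_of; apply/funext => q; apply/propext.
  by split=> -[t ->]; exists t; rewrite map_igen.
pose F s : {mpoly {fraction A}[n.+1]} := map_mpoly phi (liftT (f s)).
pose g (l : 'I_n) : {mpoly {fraction A}[n.+1]} :=
  if i == 0%N then 1 else 'X_(widen_ord (leqnSn n) l).
(* The charts cover: for i > 0 an affine equation writes 1 as a combination of the x_l, and for i =
   0 each g_l is 1. *)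
have [h1 h1P] : exists h, I (\sum_l h l * g l - 1).
  rewrite /g; case: eqP => [_|/eqP]; last rewrite -lt0n => i0.
    exists (fun l => (l == Ordinal hi)%:R); rewrite (bigD1 (Ordinal hi)) //= eqxx mulr1.
    by rewrite big1 ?addr0 ?subrr ?mulr1 => [|l /negPf ->]; [apply: ideal_0 | rewrite mul0r].
  exists (fun l => (Th (Ordinal i0) l)%:MP).
  under eq_bigr do rewrite mul_mpolyC.
  by rewrite IE; apply: ideal_of_gen; exists (inl (inl (Ordinal i0))).
(* The last generator does the same for the F_s, with cofactors T mu_s. *)
have [h2 h2P] : exists h, I (\sum_s h s * F s - 1).
  exists (fun s => 'X_ord_max * (mu 0 s)%:MP).
  under eq_bigr do rewrite -mulrA mul_mpolyC.
  rewrite -mulr_sumr mulrC; apply: (cong_sym idI).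
  by rewrite IE; apply: ideal_of_gen; exists (inr tt).
have hP : I (\sum_(ls : 'I_n * 'I_r) (h1 ls.1 * h2 ls.2) * (g ls.1 * F ls.2) - 1).
  have := congM idI h1P h2P; rewrite mulr1 big_distrlr pair_bigA.
  by congr (I (_ - _)); apply: eq_bigr => ls _; rewrite mulrACA.
apply: (quot_dim_algebraic idI) => j.
have [p pP] := choice (fun ls : 'I_n * 'I_r => algebraic_on_chart f phi Th La mu hi ls.1 ls.2 j).
have [e eP] := choice pP.
(* A single polynomial for all charts: each chart's relation divides it. *)
pose P := \prod_ls p ls.
exists (map_poly tf P).
  rewrite map_poly_eq0_id0 ?tofrac_eq0 ?lead_coef_eq0.
    by apply/prodf_neq0 => ls _; case: (eP ls).
  by apply/prodf_neq0 => ls _; case: (eP ls).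
(* The parameters are the indeterminates themselves, so evaluation at them is the embedding of A in
   its fraction field. *)
have evE (q : A) : mmap (fun c => (phi c)%:MP) (fun t => (params Th La mu 0 t)%:MP) q
    = (tf q)%:MP :> {mpoly {fraction A}[n.+1]}.
  apply: etrans (mpoly_rmorphism_mmap (@mpolyC n.+1 _ \o tf) q); congr (mmap _ _ q).
  by apply/funext => t /=; rewrite -params_generic -map_params mxE.
apply: (comaximal_cancel (k := e) idI hP) => -[l s] /=.
have [_] := eP (l, s); rewrite -IE /= => h.
rewrite /P (bigD1 (l, s)) //= rmorphM rmorphM hornerM mulrA.
apply: (ideal_Mr idI); move: h; congr (I (_ * _.['X_j])).
by apply/polyP => k; rewrite !coef_map; apply: evE.
Qed.

(** N and D precede the field L in the quantifiers; this is what later ties the dimension over Q to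
    the count over C. *)
Lemma generic_dimension : exists N (D : A), D != 0 /\
  forall (L : fieldType) (phi : {rmorphism rat -> L}) Th La mu,
    evalp phi (params Th La mu) D != 0 ->
    quot_dim (ideal_of (fun q => exists t, q = @igen n r i f L phi Th La mu t)) N.
Proof.
have [N qN] := generic_quot_dim.
have [D D0 DP] := quot_dim_specialize qN.
exists N, D; split => // L phi Th La mu /= chiD.
pose chi : {rmorphism A -> L} := mmap phi (params Th La mu 0).
have := DP _ chi chiD; congr (quot_dim (ideal_of _) N).
have chiX : map_mx chi (params ThG LaG muG) = params Th La mu.
  by apply/rowP => t; rewrite mxE params_generic /chi /= mmapX mmap1U.
rewrite map_params in chiX.
have [eTL emu] := eq_row_mx chiX; have [eTh eLa] := eq_row_mx eTL.
have chiC : chi \o @mpolyC M rat = phi by apply/funext => c /=; rewrite /chi /= mmapC.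
have gE t : map_mpoly chi (G t) = igen f phi Th La mu t.
  by rewrite /G map_igen chiC (can_inj mxvecK eTh) (can_inj mxvecK eLa) emu.
by apply/funext => q; apply/propext; split=> -[t ->]; exists t; rewrite gE.
Qed.

End GenericDimension.

(** * Finite-dimensional algebras over an algebraically closed field *)

Section Nullstellensatz.
Variables (L : closedFieldType) (m : nat).
Local Notation P := {mpoly L[m]}.
Implicit Types (I : P -> Prop) (p q h : P).

Definition add_gen I h : P -> Prop := fun p => exists q, I (p - q * h).

Lemma add_gen_ideal I h : is_ideal I -> is_ideal (add_gen I h).
Proof.
move=> idI; split.
- by exists 0; rewrite mul0r subrr; apply: ideal_0.
- move=> p p' [q qP] [q' qP']; exists (q + q').
  by have := ideal_D idI qP qP'; rewrite mulrDl opprD addrACA.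
- move=> p p' [q qP]; exists (p * q).
  by have := ideal_Ml idI p qP; rewrite mulrBr mulrA.
Qed.

Lemma add_gen_sub I h p : is_ideal I -> I p -> add_gen I h p.
Proof. by move=> idI Ip; exists 0; rewrite mul0r subr0. Qed.

Lemma add_gen_mem I h : is_ideal I -> add_gen I h h.
Proof. by move=> idI; exists 1; rewrite mul1r subrr; apply: ideal_0. Qed.

(** The N + 1 powers 1, h, .., h^N are dependent modulo I; the resulting polynomial in h splits over
    L. *)
Lemma annihilating_poly I N h : is_ideal I -> quot_dim I N ->
  exists2 s : seq L, (size s <= N)%N & I (\prod_(z <- s) (h - z%:MP)).
Proof.
move=> idI [b [_ spn]].
have /existsNP[c /not_implyP[Ic /existsNP[k0 /eqP ck0]]] :
    ~ independent I (fun k : 'I_N.+1 => h ^+ k).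
  by move=> /(independent_le_spanning idI)/(_ spn); rewrite ltnn.
pose chi := \poly_(k < N.+1) c (inord k).
have chiE : (map_poly (@mpolyC m L) chi).[h] = \sum_(k < N.+1) c k *: h ^+ k.
  rewrite (@horner_coef_wide _ N.+1); last first.
    exact: leq_trans (size_poly _ _) (size_poly _ _).
  by apply: eq_bigr => k _; rewrite coef_map coef_poly ltn_ord inord_val /= mul_mpolyC.
have chi0 : chi != 0.
  apply: contra ck0 => /eqP/(congr1 (fun p : {poly L} => p`_k0)).
  by rewrite coef_poly ltn_ord inord_val coef0 => ->.
have [s chis] := closed_field_poly_normal chi.
exists s.
  rewrite -ltnS; apply: leq_trans (size_poly N.+1 (fun k => c (inord k))).
  by rewrite -/chi chis size_scale ?lead_coef_eq0 // size_prod_XsubC.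
have lc0 : lead_coef chi != 0 by rewrite lead_coef_eq0.
have := ideal_Z (lead_coef chi)^-1 idI Ic; rewrite -chiE [in map_poly _ chi]chis.
rewrite -mul_polyC rmorphM rmorph_prod hornerM horner_prod /= map_polyC hornerC.
rewrite mul_mpolyC scalerA mulVf // scale1r; congr (I _); apply: eq_bigr => z _.
by rewrite rmorphB /= map_polyX map_polyC hornerXsubC.
Qed.

(** Factors with z <> 0 are units modulo I and can be cancelled; replacing each of them by h as well
    keeps the exponent equal to the length of s. *)
Lemma cancel_prod I (s : seq L) h q : is_ideal I ->
  (forall z, z != 0 -> exists r, I (1 - r * (h - z%:MP))) ->
  I ((\prod_(z <- s) (h - z%:MP)) * q) -> I (h ^+ size s * q).
Proof.
move=> idI inv; elim: s q => [|z s IHs] q; first by rewrite big_nil.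
rewrite big_cons /= exprSr -!mulrA.
have [->|/inv[r rP]] := eqVneq z 0.
  by rewrite mpolyC0 subr0 mulrCA => /IHs.
move=> h1; apply: IHs; rewrite mulrCA; apply: (ideal_Ml idI).
have := ideal_D idI (ideal_Mr idI ((\prod_(z <- s) (h - z%:MP)) * q) rP) (ideal_Ml idI r h1).
by congr (I _); ring.
Qed.

(** Otherwise all factors of an annihilating product of h are units modulo I, and cancelling them
    puts 1 in I. *)
Lemma proper_add_gen I N h : is_ideal I -> quot_dim I N -> ~ I 1 ->
  exists c : L, ~ add_gen I (h - c%:MP) 1.
Proof.
move=> idI qI I1; apply: contrapT => /forallNP all_unit.
have [s _ hs] := annihilating_poly h idI qI; apply: I1.
elim: s hs => [|z s IHs]; first by rewrite big_nil.
rewrite big_cons => h1; apply: IHs.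
have /contrapT[r rP] := all_unit z.
have := ideal_D idI (ideal_Mr idI (\prod_(z <- s) (h - z%:MP)) rP) (ideal_Ml idI r h1).
by congr (I _); ring.
Qed.

(** Adjoining X_j - c_j for one j after another keeps the ideal proper. Modulo the final ideal J
    every p is congruent to its value at v, and J contains no nonzero constant. *)
Lemma nullstellensatz_fin I N : is_ideal I -> quot_dim I N -> ~ I 1 ->
  exists v : 'I_m -> L, forall p, I p -> p.@[v] = 0.
Proof.
move=> idI qI I1.
have [J [idJ IJ J1 Jc]] : exists J, [/\ is_ideal J, forall p, I p -> J p, ~ J 1 &
    forall j, j \in enum 'I_m -> exists c, J ('X_j - c%:MP)].
  elim: (enum 'I_m) => [|j s [J [idJ IJ J1 Jc]]]; first by exists I.
  have [N' qJ] := quot_dim_sub idI idJ IJ qI.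
  have [c cP] := proper_add_gen 'X_j idJ qJ J1.
  exists (add_gen J ('X_j - c%:MP)); split => //.
  - exact: add_gen_ideal.
  - by move=> p /IJ; apply: add_gen_sub.
  - move=> k; rewrite inE => /predU1P[->|/Jc[d dP]].
      by exists c; apply: add_gen_mem.
    by exists d; apply: add_gen_sub.
have [v vP] := choice (fun j => Jc j (mem_enum _ j)).
exists v => p /IJ Jp; apply/eqP/negPn/negP => pv; apply: J1.
have := ideal_B idJ Jp (cong_meval p idJ vP); rewrite subKr.
move/(ideal_Ml idJ (p.@[v]^-1)%:MP); rewrite -mpolyCM mulVf //.
Qed.

(** For z <> 0, a zero of I + (h - z) would be a zero of I where h equals z; hence h - z is a unit
    modulo I, and only powers of h remain in the annihilating product. *)
Lemma vanishing_nilpotent I N h : is_ideal I -> quot_dim I N ->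
  (forall v : 'I_m -> L, (forall p, I p -> p.@[v] = 0) -> h.@[v] = 0) -> I (h ^+ N).
Proof.
move=> idI qI hv; have [s sN hs] := annihilating_poly h idI qI.
rewrite -(subnK sN) exprD; apply: (ideal_Ml idI).
rewrite -[h ^+ _]mulr1; apply: cancel_prod => //; last by rewrite mulr1.
move=> z z0; apply: contrapT => nunit.
have idJ := add_gen_ideal (h - z%:MP) idI.
have [N' qJ] := quot_dim_sub idI idJ (fun p => @add_gen_sub I (h - z%:MP) p idI) qI.
have [v vP] := nullstellensatz_fin idJ qJ nunit.
have := vP _ (add_gen_mem (h - z%:MP) idI).
rewrite mevalB mevalC hv ?sub0r => [/eqP|p Ip]; first by rewrite oppr_eq0 (negPf z0).
by apply: vP; apply: add_gen_sub.
Qed.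

End Nullstellensatz.

(** * Powers of maximal ideals and splitting into local algebras *)

Section MaximalPowers.
Variables (L : fieldType) (m : nat).
Local Notation P := {mpoly L[m]}.
Implicit Types (v p q : 'rV[L]_m) (h : P) (I : P -> Prop).

Lemma separator p q : p != q -> exists h : P, h.@[p 0] = 1 /\ h.@[q 0] = 0.
Proof.
move=> pq; have [j pqj] : exists j, p 0 j != q 0 j.
  apply/existsP; rewrite -negb_forall; apply: contra pq => /forallP e.
  by apply/eqP/rowP => j; apply/eqP.
exists ((p 0 j - q 0 j)^-1 *: ('X_j - (q 0 j)%:MP)).
rewrite !mevalZ !mevalB !mevalXU !mevalC subrr mulr0 mulVf ?subr_eq0 //.
Qed.

Lemma interpolation (s : seq 'rV[L]_m) p : exists h : P,
  h.@[p 0] = 1 /\ forall q, q \in s -> q != p -> h.@[q 0] = 0.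
Proof.
elim: s => [|q s [h [hp hs]]]; first by exists 1; rewrite meval1.
have [qp|qp] := eqVneq q p.
  exists h; split => // q'; rewrite inE => /predU1P[->|]; last exact: hs.
  by rewrite qp eqxx.
have [g [gp gq]] := separator (q := q) (p := p) ltac:(by rewrite eq_sym).
exists (g * h); rewrite mevalM gp hp mulr1; split => // q'; rewrite inE mevalM.
by case/predU1P => [->|/hs q's q'p]; rewrite ?gq ?mul0r // q's ?mulr0.
Qed.

(** Polynomials equal to 1 at one point of s and to 0 at the others are independent modulo I. *)
Lemma zeros_le_quot_dim I N (s : seq 'rV[L]_m) : is_ideal I -> quot_dim I N -> uniq s ->
  (forall v, v \in s -> forall h, I h -> h.@[v 0] = 0) -> (size s <= N)%N.
Proof.
move=> idI [b [_ spn]] us sI; have [u uP] := choice (interpolation s).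
apply: (@independent_le_spanning _ _ I _ _ (fun k : 'I_(size s) => u (tnth (in_tuple s) k))) spn => //.
move=> c Ic k; have := sI _ (mem_tnth k (in_tuple s)) _ Ic.
rewrite raddf_sum /= (bigD1 k) //= mevalZ (uP _).1 mulr1 big1 ?addr0 // => l lk.
rewrite mevalZ (uP _).2 ?mulr0 ?mem_tnth //.
by apply: contra lk => /eqP/(tuple_uniqP (in_tuple s) us) ->.
Qed.

Lemma mpow_gensM v a b h g : ideal_of (mpow_gens v a) h -> ideal_of (mpow_gens v b) g ->
  ideal_of (mpow_gens v (a + b)) (h * g).
Proof.
have idab := ideal_of_is_ideal (mpow_gens v (a + b)).
move=> ha; apply: (@ideal_of_min _ _ _ (fun g => ideal_of _ (h * g))).
  split=> [|x y hx hy|x y hy]; first by rewrite mulr0; apply: (ideal_0 idab).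
    by rewrite mulrDr; apply: (ideal_D idab).
  by rewrite mulrCA; apply: (ideal_Ml idab).
move=> _ [f' [sf' ->]]; move: h ha.
apply: (@ideal_of_min _ _ _ (fun h => ideal_of _ (h * _))).
  split=> [|x y hx hy|x y hy]; first by rewrite mul0r; apply: (ideal_0 idab).
    by rewrite mulrDl; apply: (ideal_D idab).
  by rewrite -mulrA; apply: (ideal_Ml idab).
move=> _ [f [sf ->]]; apply: ideal_of_gen; exists (fun j => (f j + f' j)%N).
rewrite big_split /= sf sf'; split => //.
by rewrite -big_split; apply: eq_bigr => j _; rewrite exprD.
Qed.

Lemma mpow_gens_vanishing v h e : h.@[v 0] = 0 -> ideal_of (mpow_gens v e) (h ^+ e).
Proof.
move=> hv; elim: e => [|e IHe].
  apply: ideal_of_gen; exists (fun=> 0%N); rewrite big1_eq; split => //.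
  by rewrite big1.
rewrite exprS -[e.+1]add1n; apply: mpow_gensM => //.
have id1 := ideal_of_is_ideal (mpow_gens v 1).
rewrite -[h]subr0 -mpolyC0 -hv; apply: (cong_meval _ id1) => j.
apply: ideal_of_gen; exists (fun k => (k == j) : nat); split.
  by rewrite (bigD1 j) //= eqxx big1 // => k /negPf ->.
by rewrite (bigD1 j) //= eqxx expr1 big1 ?mulr1 // => k /negPf ->; rewrite expr0.
Qed.

(** The generators have degree exactly e, so a monomial of degree exactly a has to be split off; its
    exponents k are raised one unit at a time below those given. *)
Lemma mpow_gens_leq v a e h : (a <= e)%N -> ideal_of (mpow_gens v e) h ->
  ideal_of (mpow_gens v a) h.
Proof.
have ida := ideal_of_is_ideal (mpow_gens v a).
move=> ae; apply: ideal_of_min => // _ [f [sf ->]].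
have : ideal_of (mpow_gens v (a + (e - a))) (\prod_j ('X_j - (v 0 j)%:MP) ^+ f j).
  by apply: ideal_of_gen; exists f; rewrite subnKC.
apply: ideal_of_min => // _ [g [sg ->]] {f sf}.
have [k [kg sk]] : exists k : 'I_m -> nat, (forall j, k j <= g j)%N /\ (\sum_j k j = a)%N.
  have : (a <= \sum_j g j)%N by rewrite sg leq_addr.
  clear; elim: a => [|a IHa] ag; first by exists (fun=> 0%N); rewrite big1_eq.
  have [k [kg sk]] := IHa (ltnW ag).
  have [j kj] : exists j, (k j < g j)%N.
    apply: contrapT => /forallNP nk; move: ag; rewrite -sk ltnNge; apply/negP/negPn.
    by apply: leq_sum => j _; rewrite leqNgt; apply/negP.
  exists (fun l => k l + (l == j))%N; split=> [l|].
    by have [->|_] := eqVneq l j; rewrite ?addn1 ?addn0.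
  rewrite big_split sk (bigD1 j) //= eqxx big1 ?addn1 // => l /negPf -> //.
rewrite (eq_bigr (fun j => ('X_j - (v 0 j)%:MP) ^+ (g j - k j) * ('X_j - (v 0 j)%:MP) ^+ k j)).
  by rewrite big_split; apply: (ideal_Ml ida); apply: ideal_of_gen; exists k.
by move=> j _; rewrite -exprD subnK.
Qed.

(** A truncated geometric series in 1 - h, whose e-th power lies in the e-th power of the maximal
    ideal. *)
Lemma inverse_mod_mpow v h e : h.@[v 0] = 1 ->
  exists g, ideal_of (mpow_gens v e) (1 - g * h).
Proof.
move=> hv; have /(mpow_gens_vanishing e) : (1 - h).@[v 0] = 0 by rewrite mevalB meval1 hv subrr.
have -> : (1 - h) ^+ e = 1 - (1 - (1 - h) ^+ e) by rewrite subKr.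
have [g ->] : exists g, 1 - (1 - h) ^+ e = g * h.
  exists (\sum_(i < e) (1 - h) ^+ i).
  by rewrite -opprB subrX1 -mulNr opprB subKr mulrC.
by exists g.
Qed.

End MaximalPowers.
(** Chinese remainders: e is 1 modulo I1 and 0 modulo I2, so e b1 and (1 - e) b2 together form a
    basis. *)
Lemma quot_dim_inter (K : fieldType) m (I1 I2 : {mpoly K[m]} -> Prop) d1 d2 e :
  is_ideal I1 -> is_ideal I2 -> I1 (1 - e) -> I2 e -> quot_dim I1 d1 -> quot_dim I2 d2 ->
  quot_dim (fun h => I1 h /\ I2 h) (d1 + d2).
Proof.
move=> id1 id2 I1e I2e [b1 [ind1 spn1]] [b2 [ind2 spn2]].
pose b (k : 'I_(d1 + d2)) := match split k with inl k1 => e * b1 k1 | inr k2 => (1 - e) * b2 k2 end.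
have sumE (c : 'I_(d1 + d2) -> K) : \sum_k c k *: b k =
    e * (\sum_k c (lshift d2 k) *: b1 k) + (1 - e) * (\sum_k c (rshift d1 k) *: b2 k).
  rewrite big_split_ord !mulr_sumr /=; congr (_ + _); apply: eq_bigr => k _.
    by rewrite /b -/(unsplit (inl k)) unsplitK scalerAr.
  by rewrite /b -/(unsplit (inr k)) unsplitK scalerAr.
exists b; split=> [c []|h].
  rewrite sumE; set s1 := \sum_k _; set s2 := \sum_k _ => h1 h2.
  have c1 : forall k, c (lshift d2 k) = 0.
    apply: ind1; rewrite -/s1.
    have := ideal_D id1 h1 (ideal_Mr id1 (s1 - s2) I1e); congr (I1 _); ring.
  have c2 : forall k, c (rshift d1 k) = 0.
    apply: ind2; rewrite -/s2.
    have := ideal_D id2 h2 (ideal_Mr id2 (s2 - s1) I2e); congr (I2 _); ring.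
  by move=> k; case: (split_ordP k) => k' ->.
have [c1 c1P] := spn1 h; have [c2 c2P] := spn2 h.
exists (fun k => match split k with inl k1 => c1 k1 | inr k2 => c2 k2 end).
rewrite sumE.
under [X in e * X]eq_bigr do rewrite -/(unsplit (inl _)) unsplitK.
under [X in (1 - e) * X]eq_bigr do rewrite -/(unsplit (inr _)) unsplitK.
set s1 := \sum_k _; set s2 := \sum_k _.
have -> : h - (e * s1 + (1 - e) * s2) = e * (h - s1) + (1 - e) * (h - s2) by ring.
split; apply: ideal_D => //.
- exact: ideal_Ml.
- exact: ideal_Mr.
- exact: ideal_Mr.
- exact: ideal_Ml.
Qed.

Lemma quot_dim_inter_seq (K : fieldType) m (V : eqType) (s : seq V)
    (J : V -> {mpoly K[m]} -> Prop) (d : V -> nat) (eps : V -> {mpoly K[m]}) :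
  (forall v, is_ideal (J v)) -> uniq s ->
  (forall v, v \in s -> quot_dim (J v) (d v)) ->
  (forall v, v \in s -> J v (1 - eps v)) ->
  (forall v w, v \in s -> w \in s -> w != v -> J w (eps v)) ->
  quot_dim (fun h => forall v, v \in s -> J v h) (\sum_(v <- s) d v).
Proof.
move=> idJ; elim: s => [|v s IHs] /=.
  move=> _ _ _ _; rewrite big_nil; exists (fun=> 0); split=> [c _ []//|h].
  by exists (fun=> 0).
case/andP => vs us dJ Je Jne; rewrite big_cons.
have in_s w : w \in s -> w \in v :: s by rewrite inE orbC => ->.
have {}IHs : quot_dim (fun h => forall w, w \in s -> J w h) (\sum_(w <- s) d w).
  apply: IHs => // [w /in_s|w /in_s|w w' /in_s ws /in_s]; [exact: dJ | exact: Je | exact: Jne].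
have ids : is_ideal (fun h => forall w, w \in s -> J w h).
  split=> [w _|p q hp hq w ws|p q hq w ws]; first exact: ideal_0.
    by apply: ideal_D; [apply: idJ | apply: hp | apply: hq].
  by apply: ideal_Ml; [apply: idJ | apply: hq].
have vv : v \in v :: s by rewrite mem_head.
apply: eq_quot_dim (quot_dim_inter (idJ v) ids (Je v vv) _ (dJ v vv) IHs).
  move=> h; split=> [[hv hs] w|hs]; first by rewrite inE => /predU1P[->|/hs].
  by split=> [|w /in_s]; apply: hs.
move=> w ws; apply: Jne => //; first exact: in_s.
by apply: contra vs => /eqP <-.
Qed.

Section LocalDecomposition.
Variables (L : closedFieldType) (m N : nat) (I : {mpoly L[m]} -> Prop) (s : seq 'rV[L]_m).
Hypotheses (idI : is_ideal I) (qI : quot_dim I N) (us : uniq s).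
Hypothesis sP : forall v, v \in s <-> (forall h, I h -> h.@[v 0] = 0).

Let J v e := ideal_of (fun q => I q \/ mpow_gens v e q).
Let idJ v e : is_ideal (J v e) := ideal_of_is_ideal _.

Lemma local_ideal_l v e h : I h -> J v e h.
Proof. by move=> Ih; apply: ideal_of_gen; left. Qed.

Lemma local_ideal_r v e h : ideal_of (mpow_gens v e) h -> J v e h.
Proof. by apply: ideal_of_min => // g sg; apply: ideal_of_gen; right. Qed.

Lemma local_decomposition : exists d : 'rV[L]_m -> nat,
  \sum_(v <- s) d v = N /\ forall v, v \in s -> exists e0, forall e, (e0 <= e)%N ->
    quot_dim (ideal_of (fun q => I q \/ mpow_gens v e q)) (d v).
Proof.
have [u uP] := choice (interpolation s).
have u1 v := (uP v).1; have u0 v := (uP v).2.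
(* A monomial of degree above mN in m variables has an exponent at least N; e0 is also at least N,
   the nilpotency exponent in [ux]. *)
pose e0 := (m * N + N.+1)%N.
have ue (v : 'rV[L]_m) : (u v ^+ e0).@[v 0] = 1 by rewrite rmorphXn /= u1 expr1n.
(* u_v (x_j - v_j) vanishes on all the zeros of I, hence is nilpotent modulo I *)
have ux v j : I ((u v * ('X_j - (v 0 j)%:MP)) ^+ N).
  apply: (vanishing_nilpotent idI qI) => w Iw.
  have ws : (\row_k w k) \in s.
    by apply/sP => h Ih; rewrite -(Iw h Ih); apply: meval_eq => k; rewrite mxE.
  have wE h : h.@[w] = h.@[(\row_k w k) 0] by apply: meval_eq => k; rewrite mxE.
  rewrite mevalM mevalB mevalXU mevalC; have [wv|wv] := eqVneq (\row_k w k) v.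
    by rewrite -wv mxE subrr mulr0.
  by rewrite wE u0 ?mul0r.
(* Modulo I, u_v^e0 kills the e0-th power of the maximal ideal at v: by the choice of e0, each
   generator times u_v^e0 contains the N-th power of some u_v (x_j - v_j). *)
have ug v g : ideal_of (mpow_gens v e0) g -> I (u v ^+ e0 * g).
  apply: (@ideal_of_min _ _ _ (fun g => I (u v ^+ e0 * g))).
    split=> [|x y hx hy|x y hy]; first by rewrite mulr0; apply: (ideal_0 idI).
      by rewrite mulrDr; apply: (ideal_D idI).
    by rewrite mulrCA; apply: (ideal_Ml idI).
  move=> _ [a [sa ->]].
  have [j ja] : exists j, (N <= a j)%N.
    apply: contrapT => /forallNP na.
    have : (\sum_j a j <= m * N)%N.
      rewrite -[X in (X * N)%N]card_ord -sum_nat_const; apply: leq_sum => j _.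
      by have /negP := na j; rewrite -ltnNge => /ltnW.
    by rewrite sa /e0 addnS ltnNge leq_addr.
  rewrite (bigD1 j) //= -(subnK ja) exprD.
  have Ne0 : (N <= e0)%N by rewrite /e0 addnS leqW // leq_addl.
  rewrite -(subnK Ne0) exprD.
  have := ideal_Ml idI (u v ^+ (e0 - N) * ('X_j - (v 0 j)%:MP) ^+ (a j - N) *
    \prod_(k < m | k != j) ('X_k - (v 0 k)%:MP) ^+ a k) (ux v j).
  by rewrite exprMn; congr (I _); ring.
(* Beyond e0 the local ideal is constant: u_v^e0 is invertible modulo the e-th power of the maximal
   ideal and multiplies the e0-th power into I. *)
have stable v e h : v \in s -> (e0 <= e)%N -> J v e h <-> J v e0 h.
  move=> vs le_e; split; apply: ideal_of_min => // g [Ig|gg].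
  - exact: local_ideal_l.
  - by apply: local_ideal_r; apply: mpow_gens_leq le_e _; apply: ideal_of_gen.
  - exact: local_ideal_l.
  have [w wP] := inverse_mod_mpow e (ue v).
  have -> : g = w * (u v ^+ e0 * g) + (1 - w * u v ^+ e0) * g by ring.
  apply: (ideal_D (idJ v e)); last first.
    by apply: (ideal_Mr (idJ v e)); apply: local_ideal_r; apply: wP.
  by apply: local_ideal_l; apply: (ideal_Ml idI); apply: ug; apply: ideal_of_gen.
have [w wP] := choice (fun v => inverse_mod_mpow e0 (ue v)).
have [d dP] := choice (fun v => quot_dim_sub idI (idJ v e0) (@local_ideal_l v e0) qI).
exists d; split; last first.
  move=> v vs; exists e0 => e le_e.
  apply: eq_quot_dim (dP v) => h; have [le1 le2] := stable v e h vs le_e; by split.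
have q2 : quot_dim (fun h => forall v, v \in s -> J v e0 h) (\sum_(v <- s) d v).
  apply: (@quot_dim_inter_seq _ _ _ _ (fun v => J v e0) d (fun v => w v * u v ^+ e0)) => //.
    by move=> v vs; apply: local_ideal_r.
  move=> v v' vs v's v'v; apply: (ideal_Ml (idJ _ _)); apply: local_ideal_r.
  by apply: mpow_gens_vanishing; apply: u0.
(* It remains to see that the local ideals intersect in I. For h in all of them, u_v^e0 h is in I
   for every v, so a power of the sum of the u_v kills h modulo I; so does a power of 1 minus that
   sum, which vanishes on the zeros of I. *)
apply: (quot_dim_uniq idI _ qI); apply: eq_quot_dim q2 => h; split=> [hJ|Ih v _]; last first.
  exact: local_ideal_l.
have uh v : v \in s -> I (u v ^+ e0 * h).
  move=> /hJ; apply: (@ideal_of_min _ _ _ (fun g => I (u v ^+ e0 * g))).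
    split=> [|x y hx hy|x y hy]; first by rewrite mulr0; apply: (ideal_0 idI).
      by rewrite mulrDr; apply: (ideal_D idI).
    by rewrite mulrCA; apply: (ideal_Ml idI).
  by move=> g [Ig|gg]; [apply: (ideal_Ml idI) | apply: ug; apply: ideal_of_gen].
have idU : is_ideal (fun x => I (x * h)).
  split=> [|x y hx hy|x y hy]; first by rewrite mul0r; apply: (ideal_0 idI).
    by rewrite mulrDl; apply: (ideal_D idI).
  by rewrite -mulrA; apply: (ideal_Ml idI).
have [K KP] : exists K, I ((\sum_(v <- s) u v) ^+ K * h).
  rewrite big_seq; apply: (big_ind (fun x => exists K, I (x ^+ K * h))).
  - by exists 1%N; rewrite expr1 mul0r; apply: (ideal_0 idI).
  - move=> x y [a xa] [b yb]; exists (a + b)%N.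
    exact: (@ideal_exprD _ (fun x => I (x * h))).
  - by move=> v vs; exists e0; apply: uh.
have rest : I ((1 - \sum_(v <- s) u v) ^+ N * h).
  apply: (ideal_Mr idI); apply: (vanishing_nilpotent idI qI) => y Iy.
  have yE g : g.@[y] = g.@[(\row_k y k) 0] by apply: meval_eq => k; rewrite mxE.
  have ys : (\row_k y k) \in s by apply/sP => g Ig; rewrite -yE Iy.
  rewrite yE mevalB meval1 (raddf_sum (meval _)) /= (bigD1_seq _ ys) //= u1 big_seq_cond big1 ?addr0 ?subrr //.
  by move=> v /andP[vs vw]; apply: u0 => //; rewrite eq_sym.
have := @ideal_exprD _ (fun x => I (x * h)) idU _ _ _ _ KP rest.
by rewrite addrC subrK expr1n mul1r.
Qed.

End LocalDecomposition.

(** * Removing the auxiliary variable *)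

Section Rabinowitsch.
Variables (L : closedFieldType) (n : nat).
Local Notation P := {mpoly L[n]}.
Local Notation PT := {mpoly L[n.+1]}.
Local Notation x j := ('X_(widen_ord (leqnSn n) j)).
Local Notation T := ('X_ord_max : PT).

Definition extend : {rmorphism P -> PT} := mmap (@mpolyC n.+1 L) (fun j => x j).

Definition subst_last (w : P) : {rmorphism PT -> P} :=
  mmap (@mpolyC n L) (fun j => if insub (j : nat) is Some k then 'X_k else w).

Lemma extendC c : extend c%:MP = c%:MP. Proof. exact: mmapC. Qed.

Lemma extendZ c h : extend (c *: h) = c *: extend h.
Proof. by rewrite -mul_mpolyC rmorphM extendC mul_mpolyC. Qed.

Lemma extendX j : extend 'X_j = x j.
Proof. by rewrite /extend /= mmapX mmap1U. Qed.

Lemma subst_lastX w j : subst_last w (x j) = 'X_j.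
Proof. by rewrite /subst_last /= mmapX mmap1U /= (valK j). Qed.

Lemma subst_lastT w : subst_last w T = w.
Proof. by rewrite /subst_last /= mmapX mmap1U /= insubN // ltnn. Qed.

Lemma subst_lastC w c : subst_last w c%:MP = c%:MP. Proof. exact: mmapC. Qed.

Lemma extendK w h : subst_last w (extend h) = h.
Proof.
elim/mpolyind: h => [|c e h _ _ IHh]; first by rewrite !rmorph0.
rewrite !rmorphD IHh; congr (_ + _).
rewrite -mul_mpolyC !rmorphM extendC subst_lastC mpolyXE_id !rmorph_prod; congr (_ * _).
by apply: eq_bigr => j _; rewrite !rmorphXn extendX subst_lastX.
Qed.

Lemma subst_lastK I w p : is_ideal I -> I (T - extend w) -> I (p - extend (subst_last w p)).
Proof.
move=> idI Tw; elim/mpolyind: p => [|c e p _ _ IHp].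
  by rewrite !rmorph0 subrr; apply: ideal_0.
rewrite (rmorphD (subst_last w)) (rmorphD extend) opprD addrACA.
apply: (ideal_D idI _ IHp).
rewrite -mul_mpolyC (rmorphM (subst_last w)) (rmorphM extend) subst_lastC extendC.
apply: (congM idI); first exact: cong_refl.
rewrite mpolyXE_id (rmorph_prod (subst_last w)) (rmorph_prod extend).
apply: (cong_prod idI) => j _.
rewrite (rmorphXn (subst_last w)) (rmorphXn extend); apply: (congX idI).
have [jn|nj] := ltnP j n.
  have -> : j = widen_ord (leqnSn n) (Ordinal jn) by apply: val_inj.
  by rewrite subst_lastX extendX; apply: cong_refl.
have -> : j = ord_max by apply/val_inj/eqP; rewrite eqn_leq nj -ltnS ltn_ord.
rewrite subst_lastT; exact: Tw.
Qed.

Lemma prod_subC_factor (u : P) (s : seq L) : exists k c g,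
  c != 0 /\ \prod_(z <- s) (u - z%:MP) = u ^+ k * (c%:MP + u * g).
Proof.
elim: s => [|z s [k [c [g [c0 e]]]]].
  by exists 0%N, 1, 0; rewrite oner_neq0 big_nil mulr0 addr0 mulr1.
rewrite big_cons e; have [->|z0] := eqVneq z 0.
  by exists k.+1, c, g; rewrite mpolyC0 subr0 exprS mulrA.
exists k, (- (z * c)), (c%:MP + (u - z%:MP) * g).
by rewrite oppr_eq0 mulf_neq0 // mpolyCN mpolyCM; split => //; ring.
Qed.

Variables (S : P -> Prop) (u : P) (N : nat).

Let I : PT -> Prop :=
  ideal_of (fun q => (exists2 g, S g & q = extend g) \/ q = 1 - extend u * T).
Let idI : is_ideal I := ideal_of_is_ideal _.
Hypothesis qI : quot_dim I N.

Let I_S g : S g -> I (extend g).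
Proof. by move=> Sg; apply: ideal_of_gen; left; exists g. Qed.

Let I_T : I (1 - extend u * T).
Proof. by apply: ideal_of_gen; right. Qed.

Let I_subst (J : P -> Prop) w p : is_ideal J -> (forall g, S g -> J g) -> J (1 - u * w) ->
  I p -> J (subst_last w p).
Proof.
move=> idJ JS Jw; apply: (@ideal_of_min _ _ _ (fun p => J (subst_last w p))).
  split=> [|p' q hp hq|p' q hq]; first by rewrite rmorph0; apply: (ideal_0 idJ).
    by rewrite rmorphD; apply: (ideal_D idJ).
  by rewrite rmorphM; apply: (ideal_Ml idJ).
move=> _ [[g Sg ->]| ->]; first by rewrite extendK; apply: JS.
by rewrite rmorphB rmorph1 rmorphM extendK subst_lastT.
Qed.

(** An annihilating product of u has the form u^k (c + u g) with c <> 0. Multiplying by T^k leaves c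
    + u g in I, and multiplying by T/c then gives T congruent to -g/c. *)
Lemma last_variable_poly : exists w, I (T - extend w).
Proof.
have [r _ hr] := annihilating_poly (extend u) idI qI.
have [k [c [g [c0 e]]]] := prod_subC_factor u r.
have {hr} : I (extend u ^+ k * (c%:MP + extend u * extend g)).
  have := congr1 extend e; rewrite rmorphM rmorphXn rmorphD rmorphM extendC => <-.
  rewrite rmorph_prod; move: hr; congr (I _); apply: eq_bigr => z _.
  by rewrite rmorphB extendC.
move/(ideal_Ml idI (T ^+ k)); rewrite mulrA -exprMn => hk.
have uT : I (T * extend u - 1).
  by have := cong_sym idI I_T; rewrite mulrC.
have h1 : I (c%:MP + extend u * extend g).
  have := ideal_B idI hk (ideal_Mr idI (c%:MP + extend u * extend g) (congX idI k uT)).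
  by congr (I _); rewrite expr1n; ring.
exists (- c^-1 *: g); rewrite extendZ -mul_mpolyC mpolyCN.
have cV : (c^-1)%:MP * c%:MP = 1 :> PT by rewrite -mpolyCM mulVf.
have := ideal_B idI (ideal_Ml idI ((c^-1)%:MP * T) h1)
                    (ideal_Ml idI ((c^-1)%:MP * extend g) uT).
congr (I _); transitivity ((c^-1)%:MP * c%:MP * T + (c^-1)%:MP * extend g); first by ring.
by rewrite cV; ring.
Qed.

(** The contraction of I to the polynomials without T, that is, the saturation of the ideal of S by
    u. *)
Let J h := I (extend h).

Let idJ : is_ideal J.
Proof.
rewrite /J; split=> [|p q hp hq|p q hq]; first by rewrite rmorph0; apply: (ideal_0 idI).
  by rewrite rmorphD; apply: (ideal_D idI).
by rewrite rmorphM; apply: (ideal_Ml idI).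
Qed.

Lemma contracted_quot_dim : quot_dim J N.
Proof.
have [w Tw] := last_variable_poly; have [b [ind spn]] := qI.
exists (fun k => subst_last w (b k)).
have sumE c : I (\sum_k c k *: b k - extend (\sum_k c k *: subst_last w (b k))).
  rewrite rmorph_sum; apply: (cong_sum idI) => k _; rewrite extendZ.
  by apply: (congZ _ idI); apply: subst_lastK.
split=> [c Jc|h].
  by apply: ind; have := ideal_D idI (sumE c) Jc; rewrite subrK.
have [c cP] := spn (extend h); exists c; rewrite /J (rmorphB extend).
by have := cong_trans idI cP (sumE c).
Qed.

(** T is evaluated at the inverse of u(v). *)
Lemma contracted_vanish v h : zeros idfun S v -> u.@[v 0] != 0 -> J h -> h.@[v 0] = 0.
Proof.
move=> Sv uv Jh; rewrite -(extendK ((u.@[v 0])^-1)%:MP h).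
apply: (@I_subst (fun h => h.@[v 0] = 0)) Jh => [|g Sg|].
- split=> [|p q hp hq|p q hq]; first exact: meval0.
    by rewrite mevalD hp hq addr0.
  by rewrite mevalM hq mulr0.
- exact: (Sv g Sg).
by rewrite mevalB meval1 mevalM mevalC mulfV ?subrr.
Qed.

Lemma size_zeros_le (s : seq 'rV[L]_n) : uniq s ->
  (forall v, v \in s -> zeros idfun S v /\ u.@[v 0] != 0) -> (size s <= N)%N.
Proof.
move=> us sP; apply: (zeros_le_quot_dim idJ contracted_quot_dim us) => v /sP[Sv uv] h.
exact: contracted_vanish.
Qed.

Variable s : seq 'rV[L]_n.
Hypothesis us : uniq s.
Hypothesis sP : forall v, v \in s <-> zeros idfun S v /\ u.@[v 0] != 0.

Lemma contracted_zeros v : v \in s <-> (forall h, J h -> h.@[v 0] = 0).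
Proof.
split=> [/sP[Sv uv] h|Jv]; first exact: contracted_vanish.
apply/sP; split=> [g Sg|]; first exact: (Jv g (I_S Sg)).
have [w Tw] := last_variable_poly.
have : J (1 - u * w).
  rewrite /J rmorphB rmorph1 rmorphM; apply: (cong_trans idI I_T).
  by rewrite -mulrBr; apply: (ideal_Ml idI).
move/Jv; rewrite mevalB meval1 mevalM => /eqP; rewrite subr_eq0 => /eqP h.
by apply/eqP => u0; move/eqP: h; rewrite u0 mul0r oner_eq0.
Qed.

Lemma rabinowitsch : exists d : 'rV[L]_n -> nat,
  \sum_(v <- s) d v = N /\ forall v, v \in s -> local_mult S v (d v).
Proof.
have [d [dN dP]] := local_decomposition idJ contracted_quot_dim us contracted_zeros.
exists d; split => // v vs; have [e0 eP] := dP v vs; exists e0 => e /eP.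
have [_ uv] := iffLR (sP v) vs.
have idM := ideal_of_is_ideal (fun q => S q \/ mpow_gens v e q).
apply: eq_quot_dim => h; split; apply: ideal_of_min => //.
- move=> g [Jg|gg]; last by apply: ideal_of_gen; right.
  (* Because u(v) <> 0, u has an inverse w modulo the e-th power of the maximal ideal. Substituting
     w for T shows that J adds nothing to the local ideal of S at v. *)
  have [w wP] : exists w, ideal_of (mpow_gens v e) (1 - u * w).
    have [] := @inverse_mod_mpow _ _ v ((u.@[v 0])^-1 *: u) e.
      by rewrite mevalZ mulVf.
    by move=> w; exists (u.@[v 0]^-1 *: w); rewrite -scalerAr mulrC scalerAr.
  rewrite -(extendK w g); apply: (I_subst idM) Jg => [g' Sg'|].
    by apply: ideal_of_gen; left.
  by move: wP; apply: ideal_of_min => // q qq; apply: ideal_of_gen; right.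
- exact: ideal_of_is_ideal.
- move=> g [Sg|gg]; last by apply: ideal_of_gen; right.
  by apply: ideal_of_gen; left; apply: I_S.
Qed.

End Rabinowitsch.

(** * General parameters *)

Lemma poly_nonroot (F : numFieldType) (p : {poly F}) : p != 0 -> exists t, p.[t] != 0.
Proof.
move=> p0; apply: contrapT => /forallNP pv.
have all_roots : all (root p) (mkseq (fun k => k%:R) (size p)).
  by apply/allP => t _; apply: contrapT => /negP; apply: pv.
have := max_poly_roots p0 all_roots; rewrite size_mkseq ltnn mkseq_uniq.
  by move/(_ isT).
by apply: mulrIn; apply: oner_neq0.
Qed.

(** The first m coordinates are a non-root of a nonzero coefficient of p seen as a polynomial in the
    last variable. *)
Lemma mpoly_nonroot (F : numFieldType) m (p : {mpoly F[m]}) :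
  p != 0 -> exists v : 'rV[F]_m, p.@[v 0] != 0.
Proof.
elim: m => [|m IHm] in p *.
  move=> p0; exists 0; apply: contra p0 => /eqP e.
  have : p - (p.@[(0 : 'rV[F]_0) 0])%:MP = 0.
    apply: (@cong_meval _ _ (fun q => q = 0)) => [|[]//].
    by split=> [|q r -> ->|q r ->]; rewrite ?addr0 ?mulr0.
  by rewrite e mpolyC0 subr0 => ->.
move=> p0; have [e0 e0p] : exists e, p@_e != 0.
  apply: contrapT => /forallNP pe; move/eqP: p0; apply; apply/mpolyP => e.
  by rewrite mcoeff0; apply: contrapT => /eqP; apply: pe.
pose res (e : 'X_{1..m.+1}) : 'X_{1..m} := [multinom e (widen_ord (leqnSn m) j) | j < m].
have [|v vP] := IHm ((muni p)`_(e0 ord_max)).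
  suff h : ((muni p)`_(e0 ord_max))@_(res e0) != 0.
    by apply: contra_neq h => ->; rewrite mcoeff0.
  rewrite muniE coef_sum raddf_sum /= (bigD1_seq e0) ?mcoeff_msupp //=.
  rewrite !coefZ coefXn eqxx mulr1 mcoeffZ mcoeffX eqxx mulr1 big1 ?addr0 // => e ee0.
  rewrite !coefZ coefXn; case: eqP => [e2|_]; last by rewrite mulr0 mcoeff0.
  rewrite mulr1 mcoeffZ mcoeffX; case: eqP => [/mnmP e1|_]; last by rewrite mulr0.
  case/eqP: ee0; apply/mnmP => j; have [jm|mj] := ltnP j m.
    have -> : j = widen_ord (leqnSn m) (Ordinal jm) by apply: val_inj.
    by have := e1 (Ordinal jm); rewrite !mnmE.
  by have -> : j = ord_max by apply/val_inj/eqP; rewrite eqn_leq mj -ltnS ltn_ord.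
have [|t tP] := @poly_nonroot F (map_poly (meval (v 0)) (muni p)).
  by apply: contra_neq vP => /(congr1 (fun q : {poly F} => q`_(e0 ord_max))); rewrite coef_map coef0.
pose w : 'rV[F]_m.+1 := \row_j if insub (j : nat) is Some k then v 0 k else t.
exists w; apply: contra_neq tP => <-.
rewrite muniE mevalE rmorph_sum horner_sum; apply: eq_bigr => e _ /=.
rewrite map_polyZ map_polyXn hornerZ hornerXn /= mevalZ mevalX -mulrA big_ord_recr /=.
congr (_ * (_ * _)); last by rewrite mxE insubN // ltnn.
by apply: eq_bigr => j _; rewrite mnmE mxE /= (valK j).
Qed.

(** Finiteness is drawn from a bound on finite lists because the bound for the points outside X
    comes from a mu that depends on the list. *)
Lemma finite_of_bounded (V : eqType) (Q : V -> Prop) N :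
  (forall s, uniq s -> (forall v, v \in s -> Q v) -> (size s <= N)%N) ->
  exists2 s, uniq s & forall v, v \in s <-> Q v.
Proof.
move=> bnd; apply: contrapT => nofin.
suff [s [us sQ sN]] : exists s, [/\ uniq s, forall v, v \in s -> Q v & size s = N.+1].
  by have := bnd s us sQ; rewrite sN ltnn.
elim: N.+1 => [|k [s [us sQ sk]]]; first by exists [::].
have [v [vs Qv]] : exists v, v \notin s /\ Q v.
  apply: contrapT => /forallNP h; apply: nofin; exists s => // v; split=> [/sQ //|Qv].
  by apply/negPn/negP => vs; apply: (h v).
exists (v :: s); rewrite /= vs us sk; split => // w.
by rewrite inE => /predU1P[->|/sQ].
Qed.

Lemma mpoly_rmorphism_eq (R : nzRingType) (S : comNzRingType) m
    (h1 h2 : {rmorphism {mpoly R[m]} -> S}) :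
  (forall c, h1 c%:MP = h2 c%:MP) -> (forall j, h1 'X_j = h2 'X_j) -> h1 =1 h2.
Proof.
move=> eC eX p; rewrite -[LHS]mpoly_rmorphism_mmap -[RHS]mpoly_rmorphism_mmap; apply: eq_bigr => e _.
by congr (_ * _); [apply: eC | apply: eq_bigr => j _; rewrite eX].
Qed.

Lemma meval_map_mpoly (R S : comNzRingType) (phi : {rmorphism R -> S}) m (v : 'I_m -> S) p :
  (map_mpoly phi p).@[v] = mmap phi v p.
Proof.
apply: (mpoly_rmorphism_eq (h1 := meval v \o map_mpoly phi) (h2 := mmap phi v)) => [c|j] /=.
  by rewrite map_mpolyC mevalC mmapC.
by rewrite map_mpolyX mevalXU mmapX mmap1U.
Qed.

Lemma rmorph_meval (R S : comNzRingType) (phi : {rmorphism R -> S}) m (v : 'I_m -> R) p :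
  phi p.@[v] = mmap phi (phi \o v) p.
Proof.
apply: (mpoly_rmorphism_eq (h1 := phi \o meval v) (h2 := mmap phi (phi \o v))) => [c|j] /=.
  by rewrite mevalC mmapC.
by rewrite mevalXU mmapX mmap1U.
Qed.

Lemma IgensE n r i (f : 'I_r -> {mpoly rat[n]}) (Th : 'M[rat]_(i, n)) La mu q :
  Igens f Th La mu q <-> exists t, q = igen f idfun Th La mu t.
Proof.
have mapF j : map_mpoly idfun (liftT (f j)) = liftT (f j).
  by apply/mpolyP => e; rewrite mcoeff_map_mpoly.
have eF (c : 'I_r -> rat) :
    \sum_j c j *: map_mpoly idfun (liftT (f j)) = \sum_j c j *: liftT (f j).
  by apply: eq_bigr => j _; rewrite mapF.
split=> [[[k ->]|[[k ->]| ->]]|[[[k|k]|[]] ->]] /=; rewrite ?eF.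
- by exists (inl (inl k)).
- by exists (inl (inr k)); rewrite /= eF.
- by exists (inr tt); rewrite /= eF.
- by left; exists k.
- by right; left; exists k.
- by right; right.
Qed.

Section SplitEvaluation.
Variables (C : comNzRingType) (phi : {rmorphism rat -> C}) (k r : nat).
Implicit Types (D : {mpoly rat[k + r]}) (a : 'rV[C]_k) (b : 'rV[C]_r).

(** Freezing mu yields the polynomial in Theta, Lambda asked for by [is_gi]; [fix_left] conversely
    lets mu vary over a fixed pair. *)
Definition fix_right b : {rmorphism {mpoly rat[k + r]} -> {mpoly C[k]}} :=
  mmap (@mpolyC k C \o phi)
    (fun t => match split t with inl t' => 'X_t' | inr j => (b 0 j)%:MP end).

Definition fix_left a : {rmorphism {mpoly rat[k + r]} -> {mpoly C[r]}} :=
  mmap (@mpolyC r C \o phi)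
    (fun t => match split t with inl t' => (a 0 t')%:MP | inr j => 'X_j end).

Lemma fix_rightE a b D : (fix_right b D).@[a 0] = mmap phi (row_mx a b 0) D.
Proof.
apply: (mpoly_rmorphism_eq (h1 := meval (a 0) \o fix_right b) (h2 := mmap phi (row_mx a b 0))).
  by move=> c /=; rewrite !mmapC /= mevalC.
move=> t /=; rewrite !mmapX !mmap1U /= mxE.
by case: (split t) => j; rewrite ?mevalXU ?mevalC.
Qed.

Lemma fix_leftE a b D : (fix_left a D).@[b 0] = mmap phi (row_mx a b 0) D.
Proof.
apply: (mpoly_rmorphism_eq (h1 := meval (b 0) \o fix_left a) (h2 := mmap phi (row_mx a b 0))).
  by move=> c /=; rewrite !mmapC /= mevalC.
move=> t /=; rewrite !mmapX !mmap1U /= mxE.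
by case: (split t) => j; rewrite ?mevalXU ?mevalC.
Qed.

End SplitEvaluation.

(** * Complex fibres: points outside X, their number and multiplicities *)

Section Complex.
Variables (R : realType) (n r i : nat) (f : 'I_r -> {mpoly rat[n]}).
Hypothesis hi : (i < n)%N.
Local Notation C := (R[i]).
Let rr : {rmorphism rat -> C} := @ratr C.

Lemma fC_meval j (v : 'rV[C]_n) : (fC R f j).@[v 0] = evalp (@ratr C) v (f j).
Proof. exact: (meval_map_mpoly rr). Qed.

Lemma map_liftT (p : {mpoly rat[n]}) : map_mpoly rr (liftT p) = extend C n (map_mpoly rr p).
Proof.
pose lT : {rmorphism {mpoly rat[n]} -> {mpoly rat[n.+1]}} :=
  mmap (@mpolyC n.+1 rat) (fun j => 'X_(widen_ord (leqnSn n) j)).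
apply: (mpoly_rmorphism_eq (h1 := map_mpoly rr \o lT) (h2 := extend C n \o map_mpoly rr)).
  by move=> c /=; rewrite mmapC !map_mpolyC extendC.
by move=> j /=; rewrite mmapX mmap1U !map_mpolyX extendX.
Qed.

Section Fiber.
Variables (Th : 'M[C]_(i, n)) (La : 'M[C]_(n - i, r)).
Let u (mu : 'rV[C]_r) : {mpoly C[n]} := \sum_j mu 0 j *: fC R f j.
Let S := Jgens f Th La.

Lemma igen_rabinowitsch mu q :
  (exists t, q = igen f rr Th La mu t) <->
  ((exists2 g, S g & q = extend C n g) \/ q = 1 - extend C n (u mu) * 'X_ord_max).
Proof.
have eTh k : extend C n (\sum_j Th k j *: 'X_j - 1) = igen f rr Th La mu (inl (inl k)).
  rewrite (rmorphB (extend C n)) rmorph1 (rmorph_sum (extend C n)) /=; congr (_ - _).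
  by apply: eq_bigr => j _; rewrite extendZ extendX.
have eF (c : 'I_r -> C) : extend C n (\sum_j c j *: fC R f j) =
    \sum_j c j *: map_mpoly rr (liftT (f j)).
  rewrite (rmorph_sum (extend C n)); apply: eq_bigr => j _.
  by rewrite extendZ map_liftT.
split=> [[[[k|k]|[]] ->]|[[_ [[k ->]|[k ->]] ->]| ->]].
- by left; exists (\sum_j Th k j *: 'X_j - 1); [left; exists k | rewrite eTh].
- by left; exists (\sum_j La k j *: fC R f j); [right; exists k | rewrite eF].
- by right; rewrite /u eF.
- by exists (inl (inl k)); rewrite eTh.
- by exists (inl (inr k)); rewrite eF.
- by exists (inr tt); rewrite /u eF.
Qed.

Variables (N : nat) (D : {mpoly rat[i * n + (n - i) * r + r]}).
Hypothesis DP : forall mu, evalp rr (params Th La mu) D != 0 ->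
  quot_dim (ideal_of (fun q => exists t, q = igen f rr Th La mu t)) N.
Variable mu0 : 'rV[C]_r.
Hypothesis Dmu0 : evalp rr (params Th La mu0) D != 0.

Let Q v := zeros idfun S v /\ ~ inX f v.

(** For v outside X, mu.f(v) is a nonzero linear form in mu, and D is nonzero in mu because of
    [mu0]; a non-root of the product of D with these forms is the required mu. *)
Lemma generic_mu (s : seq 'rV[C]_n) : (forall v, v \in s -> Q v) ->
  exists2 mu, evalp rr (params Th La mu) D != 0 & forall v, v \in s -> (u mu).@[v 0] != 0.
Proof.
move=> sQ; pose a := row_mx (mxvec Th) (mxvec La).
pose lin (v : 'rV[C]_n) : {mpoly C[r]} := \sum_j (fC R f j).@[v 0] *: 'X_j.
have linE v (mu : 'rV[C]_r) : (lin v).@[mu 0] = (u mu).@[v 0].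
  rewrite /lin /u !(raddf_sum (meval _)) /=; apply: eq_bigr => j _.
  by rewrite !mevalZ mevalXU mulrC.
have [|mu] := @mpoly_nonroot _ _ (fix_left rr r a D * \prod_(v <- s) lin v).
  rewrite mulf_neq0 //.
    by apply: contra_neq Dmu0 => h; rewrite /evalp -fix_leftE h meval0.
  rewrite prodf_seq_neq0; apply/allP => v /sQ[_ /existsNP[j fj]] /=.
  apply/eqP => lv; apply: fj; rewrite -fC_meval.
  have <- : (u (delta_mx 0 j)).@[v 0] = (fC R f j).@[v 0].
    rewrite -linE (raddf_sum (meval _)) (bigD1 j) //= mevalZ mevalXU mxE !eqxx mulr1.
    by rewrite big1 ?addr0 // => k /negPf kj; rewrite mevalZ mevalXU mxE kj andbF mulr0.
  by rewrite -linE lv; apply: meval0.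
rewrite mevalM mulf_eq0 negb_or fix_leftE => /andP[Dmu lmu]; exists mu => // v vs.
move: lmu; rewrite rmorph_prod prodf_seq_neq0 => /allP/(_ v vs) /=.
by rewrite linE.
Qed.

Lemma deg_outside_generic : deg_outside f Th La N.
Proof.
have uX (v : 'rV[C]_n) mu : (u mu).@[v 0] != 0 -> ~ inX f v.
  move=> uv fv; case/eqP: uv; rewrite /u (raddf_sum (meval _)) /= big1 // => j _.
  by rewrite mevalZ fC_meval fv mulr0.
have qD mu : evalp rr (params Th La mu) D != 0 ->
    quot_dim (ideal_of (fun q => (exists2 g, S g & q = extend C n g) \/
      q = 1 - extend C n (u mu) * 'X_ord_max)) N.
  move/DP; congr (quot_dim (ideal_of _) N); apply/funext => q; apply/propext.
  exact: igen_rabinowitsch.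
(* Every finite list of points of Q lies in mu.f <> 0 for a suitable mu, and the dimension N bounds
   its length. *)
have [s us sQ] : exists2 s, uniq s & forall v, v \in s <-> Q v.
  apply: (@finite_of_bounded _ Q N) => s us sQ.
  have [mu Dmu umu] := generic_mu sQ.
  by apply: (size_zeros_le (qD mu Dmu) us) => v vs; split; [case: (sQ v vs) | apply: umu].
(* A second choice of mu, now adapted to the complete list. *)
have [mu Dmu umu] := generic_mu (fun v => iffLR (sQ v)).
have [|d [dN dP]] := rabinowitsch (qD mu Dmu) us (s := s).
  move=> v; split=> [vs|[Sv uv]]; first by split; [case: (iffLR (sQ v) vs) | apply: umu].
  by apply/sQ; split => //; apply: uX uv.
exists s, d; split=> //; split; first by move=> v; have [h1 h2] := sQ v; split.
by split.
Qed.

End Fiber.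

(** Complex zeros of the rational ideal are zeros of the ideal with the same generators over C,
    whose quotient dimension N bounds their number. *)
Lemma zero_dim_generic N Th La mu :
  quot_dim (ideal_of (fun q => exists t,
    q = igen f rr (map_mx rr Th) (map_mx rr La) (map_mx rr mu) t)) N ->
  unit_ideal (@Igens n r i f Th La mu) \/ zero_dim (@ratr C) (Igens f Th La mu).
Proof.
move=> qI; case: (pselect (unit_ideal (Igens f Th La mu))) => [|nu]; [by left | right].
split => //.
have [s us sP] : exists2 s, uniq s & forall v, v \in s <-> zeros (@ratr C) (Igens f Th La mu) v.
  apply: (@finite_of_bounded _ _ N) => s us sZ.
  apply: (zeros_le_quot_dim (ideal_of_is_ideal _) qI us) => v /sZ vZ h.
  apply: (@evalp_ideal_of _ _ _ idfun) => _ [t ->]; rewrite /evalp.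
  rewrite -(map_igen f rr idfun Th La mu t) -/(meval _ _) meval_map_mpoly.
  by apply: vZ; apply/IgensE; exists t.
by exists s => v /sP.
Qed.

End Complex.

Theorem theorem4p1 (R : realType) (n r i : nat) (hi : (i < n)%N)
  (f : 'I_r -> {mpoly rat[n]}) :
  exists N : nat,
    @is_gi n r i R f N /\
    exists PQ : {mpoly rat[i * n + (n - i) * r + r]},
      PQ != 0 /\
      forall (Th : 'M[rat]_(i, n)) (La : 'M[rat]_(n - i, r)) (mu : 'rV[rat]_r),
        evalp idfun (row_mx (row_mx (mxvec Th) (mxvec La)) mu) PQ != 0 ->
        (unit_ideal (Igens f Th La mu) \/
         zero_dim (@ratr R[i]) (Igens f Th La mu)) /\
        quot_dim (ideal_of (Igens f Th La mu)) N.
Proof.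
have [N [D [D0 DP]]] := generic_dimension f hi.
pose rr : {rmorphism rat -> R[i]} := @ratr R[i].
have ratD (a : 'rV[rat]_(i * n + (n - i) * r + r)) :
    evalp rr (map_mx rr a) D = rr (evalp idfun a D).
  rewrite [in RHS]/evalp -/(meval _ _) rmorph_meval /evalp.
  by congr (mmap _ _ D); apply/funext => t /=; rewrite mxE.
exists N; split.
  (* A rational point off D = 0 supplies mu0; D with mu frozen there is nonzero, as it does not
     vanish at the Theta, Lambda part of the point. *)
  have [a aD] := mpoly_nonroot D0.
  pose mu0 := map_mx rr (rsubmx a).
  exists (fix_right rr _ mu0 D); split.
    apply: contra_neq aD => h; apply: (fmorph_inj rr).
    rewrite rmorph0 -[LHS](ratD a) -[a]hsubmxK map_row_mx /evalp -fix_rightE h.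
    exact: meval0.
  move=> Th La; rewrite /evalp -/(meval _ _) fix_rightE => Dmu0.
  by apply: (deg_outside_generic _ Dmu0) => mu; apply: DP.
exists D; split=> // Th La mu Dne0; split.
  (* Non-vanishing of D at rational parameters is carried to C by [ratD], where [DP] gives the
     dimension of the complex quotient. *)
  apply: (@zero_dim_generic R n r i f N); apply: DP.
  rewrite /params -!map_mxvec -!map_row_mx ratD.
  by rewrite fmorph_eq0.
have := DP rat idfun Th La mu Dne0; congr (quot_dim (ideal_of _) N).
by apply/funext => q; apply/propext; have [h1 h2] := IgensE f Th La mu q; split.
Qed.
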